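(* Let $\mathcal{G}$ be a second countable, Hausdorff, locally compact, totally disconnected topological group and let $T:\mathcal{G}\to\mathcal{G}$ be a continuous group automorphism. (1) If the points with compact $T$-orbit closure are dense in $\mathcal{G}$, then $(\mathcal{G},T)$ is topologically conjugate to an inverse limit of systems, each of which is the product of a full-shift on a finite alphabet and a permutation of a countable discrete set for which every orbit is finite. (2) If the points with compact $T$-orbit closure are not dense in $\mathcal{G}$, then $(\mathcal{G},T)$ is topologically conjugate to an inverse limit of systems, each of which is the product of a full-shift on a finite alphabet and an essentially wandering countable state Markov shift.
   Context: The $T$-orbit of $x$ is $\{T^n(x):n\in\mathbb{Z}\}$. A system is a topological space with a homeomorphism; a topological conjugacy between systems is a homeomorphism intertwining the two maps. The inverse limit is that of a sequence of systems indexed by $\mathbb{N}$, whose bonding maps are continuous surjections intertwining the maps (factor maps), with the induced homeomorphism. The full-shift on a finite alphabet $A$ is $A^{\mathbb{Z}}$ (product topology, $A$ discrete) with the shift $\sigma(x)_i=x_{i+1}$. A (one-step) countable state Markov shift is the set of all bi-infinite sequences over a countable discrete alphabet $A$ all of whose consecutive pairs $(x_i,x_{i+1})$ lie in a fixed set of allowed transitions in $A\times A$, with the topology induced from $A^{\mathbb{Z}}$ and the shift map. A system $(X,S)$, with $X$ an infinite topological space and $S$ a homeomorphism of $X$, is essentially wandering if (i) the set of points of $X$ with compact $S$-orbit closure is countable and each such point is periodic, and (ii) $X$ contains points with noncompact orbit closure. *)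

(* Defs.v *)
From HB Require Import structures.
From mathcomp Require Import all_boot all_order all_algebra.
From mathcomp Require Import all_classical.
From mathcomp Require Import topology.

Set Implicit Arguments.
Unset Strict Implicit.
Unset Printing Implicit Defensive.

Import Order.TTheory GRing.Theory Num.Theory.
Local Open Scope classical_set_scope.
Local Open Scope ring_scope.

(* MathComp-Analysis only has topological groups in additive (commutative)
   notation. *)
HB.structure Definition PreTopologicalGroup := {G of Topological G & Group G}.

HB.mixin Record PreTopologicalGroup_isTopologicalGroup G
    & PreTopologicalGroup G := {
  mulg_continuous : continuous (fun p : G * G => (p.1 * p.2)%g);
  invg_continuous : continuous (fun x : G => (x^-1)%g)
}.

#[short(type="topologicalGroupType")]
HB.structure Definition TopologicalGroup :=
  {G of PreTopologicalGroup G & PreTopologicalGroup_isTopologicalGroup G}.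

Definition homeomorphism (X Y : topologicalType) (f : X -> Y) : Prop :=
  continuous f /\
  exists g : Y -> X, [/\ cancel f g, cancel g f & continuous g].

Record system := System {
  space :> topologicalType;
  act : space -> space;
  act_homeo : homeomorphism act
}.
Arguments act {s} _.

Definition topologically_conjugate (X Y : topologicalType)
    (S : X -> X) (S' : Y -> Y) : Prop :=
  exists f : X -> Y, homeomorphism f /\ forall x, f (S x) = S' (f x).

(* For bijective [S], the condition [iter n S y = x] says that y = S^(-n) x, so
   that this is the two-sided orbit. *)
Definition zorbit (X : Type) (S : X -> X) (x : X) : set X :=
  [set y | exists n : nat, y = iter n S x \/ iter n S y = x].

Definition compact_orbit_closure (X : topologicalType) (S : X -> X) : set X :=
  [set x | compact (closure (zorbit S x))].

Definition periodic (X : Type) (S : X -> X) (x : X) : Prop :=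
  exists n : nat, (0 < n)%N /\ iter n S x = x.

Definition essentially_wandering (X : system) : Prop :=
  [/\ infinite_set [set: X],
      countable (compact_orbit_closure (@act X)),
      forall x : X, compact_orbit_closure act x -> periodic act x
    & exists x : X, ~ compact_orbit_closure act x].

Definition factor_map (X Y : system) (f : X -> Y) : Prop :=
  [/\ continuous f,
      forall y, exists x, f x = y
    & forall x, f (act x) = act (f x)].

Section Subsystem.
Variables (X : system) (A : set X).
Hypothesis A_inv : forall x, A (act x) <-> A x.

Let sub_in (x : A) : act (val x) \in A.
Proof. by apply/mem_set/A_inv/set_mem/valP. Qed.

Definition sub_act (x : A) : A := exist _ (act (val x)) (sub_in x).

Lemma continuous_set_val (Y : topologicalType) (f : Y -> A) :
  continuous (fun y => val (f y)) -> continuous f.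
Proof.
by move=> cf; apply: (@continuous_comp_initial A Y X set_val f); exact: cf.
Qed.

Lemma sub_act_homeo : homeomorphism sub_act.
Proof.
have [cS [g [Sg gS cg]]] := act_homeo X.
have cval : continuous (fun x : A => val x).
  exact: (@initial_continuous A X set_val).
have g_in (x : A) : g (val x) \in A.
  by apply/mem_set/A_inv; rewrite gS; exact/set_mem/valP.
split.
  apply: continuous_set_val => x.
  exact: (continuous_comp (@cval x) (@cS (val x))).
exists (fun x : A => exist _ (g (val x)) (g_in x) : A); split.
- by move=> x; apply: val_inj; rewrite /= Sg.
- by move=> x; apply: val_inj; rewrite /= gS.
- apply: continuous_set_val => x.
  exact: (continuous_comp (@cval x) (@cg (val x))).
Qed.

Definition subsystem : system := System sub_act_homeo.

End Subsystem.

Section Product.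
Variables X Y : system.

Definition prod_act (z : X * Y) : X * Y := (act z.1, act z.2).

Lemma prod_act_homeo : homeomorphism prod_act.
Proof.
have pair_continuous (f : X -> X) (g : Y -> Y) :
    continuous f -> continuous g ->
    continuous (fun z : X * Y => (f z.1, g z.2)).
  move=> cf cg z; apply: cvg_pair.
    exact: (continuous_comp (@cvg_fst _ _ _ _ _) (@cf z.1)).
  exact: (continuous_comp (@cvg_snd _ _ _ _ _) (@cg z.2)).
have [cS [g [Sg gS cg]]] := act_homeo X.
have [cS' [g' [Sg' gS' cg']]] := act_homeo Y.
split; first exact: pair_continuous.
exists (fun z => (g z.1, g' z.2)); split; last exact: pair_continuous.
- by case=> x y; rewrite /prod_act /= Sg Sg'.
- by case=> x y; rewrite /prod_act /= gS gS'.
Qed.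

Definition prod_system : system := System prod_act_homeo.

End Product.

Lemma continuous_prod_topology (I : Type) (Y : I -> topologicalType)
    (X : topologicalType) (f : X -> prod_topology Y) :
  (forall i, continuous (fun x => f x i)) -> continuous f.
Proof.
move=> cf x; apply/cvg_sup => i.
move=> U [_ [[B oB <-] Bfx] BU]; apply: filterS BU _.
by apply: cf; exact: open_nbhs_nbhs.
Qed.

Section InverseLimit.
Variables (X : nat -> system) (p : forall n, X n.+1 -> X n).
Hypothesis p_factor : forall n, factor_map (@p n).

Let prod_space : topologicalType := prod_topology (fun n => space (X n)).

Definition pointwise_act (x : prod_space) : prod_space := fun n => act (x n).

Lemma pointwise_act_homeo : homeomorphism pointwise_act.
Proof.
have pw_continuous (f : forall n, X n -> X n) :
    (forall n, continuous (f n)) ->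
    continuous (fun x : prod_space => (fun n => f n (x n)) : prod_space).
  move=> cf; apply: continuous_prod_topology => n x.
  exact: (continuous_comp (@proj_continuous _ _ n x) (@cf n (x n))).
split.
  apply: (pw_continuous (fun n => @act (X n))) => n.
  by have [] := act_homeo (X n).
pose g n := projT1 (cid (act_homeo (X n)).2).
have gP n : [/\ cancel act (g n), cancel (g n) act & continuous (g n)].
  exact: projT2 (cid (act_homeo (X n)).2).
exists (fun x n => g n (x n)); split.
- move=> x; apply: functional_extensionality_dep => n.
  by have [actK _ _] := gP n; exact: actK.
- move=> x; apply: functional_extensionality_dep => n.
  by have [_ gK _] := gP n; exact: gK.
- by apply: (pw_continuous g) => n; have [] := gP n.
Qed.

Definition pointwise_system : system := System pointwise_act_homeo.

Definition threads : set pointwise_system :=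
  [set x : prod_space | forall n, p (x n.+1) = x n].

Lemma threads_inv (x : pointwise_system) : threads (act x) <-> threads x.
Proof.
have pE n : p (act (x n.+1)) = act (p (x n.+1)) by have [] := p_factor n.
have act_inj n : injective (@act (X n)).
  by have [_ [g [actK _ _]]] := act_homeo (X n); exact: can_inj actK.
split=> tx n; last by apply: etrans (pE n) _; congr act; exact: tx.
by apply: act_inj; rewrite -pE; exact: tx.
Qed.

Definition inverse_limit : system := subsystem threads_inv.

End InverseLimit.

Section Shift.
Variable A : choiceType.

Let sequences : topologicalType :=
  prod_topology (fun _ : int => discrete_topology A).

Definition shift (x : sequences) : sequences := fun i => x (i + 1).

Lemma shift_homeo : homeomorphism shift.
Proof.
split.
  apply: continuous_prod_topology => i.
  exact: (@proj_continuous _ (fun=> discrete_topology A)).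
exists (fun x i => x (i - 1)); split.
- by move=> x; apply/funext => i; rewrite /shift subrK.
- by move=> x; apply/funext => i; rewrite /shift addrK.
- apply: continuous_prod_topology => i.
  exact: (@proj_continuous _ (fun=> discrete_topology A)).
Qed.

Definition shift_system : system := System shift_homeo.

Variable E : set (A * A).

Definition admissible : set shift_system :=
  [set x : sequences | forall i : int, E (x i, x (i + 1))].

Lemma admissible_inv (x : shift_system) : admissible (act x) <-> admissible x.
Proof.
split=> Ex i; last exact: Ex.
by have := Ex (i - 1); rewrite /= /shift subrK.
Qed.

End Shift.

Definition full_shift (A : finType) : system := shift_system A.

Definition markov_shift (A : countType) (E : set (A * A)) : system :=
  subsystem (@admissible_inv A E).

Section Permutation.
Variables (D : countType) (pi : D -> D).
Hypothesis pi_bij : bijective pi.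

Definition perm_act : discrete_topology D -> discrete_topology D := pi.

Lemma perm_act_homeo : homeomorphism perm_act.
Proof.
have dcont (f : discrete_topology D -> discrete_topology D) : continuous f.
  move=> x U /nbhs_singleton Ufx; have x1 := discrete_set1 x.
  by apply: (@filterS _ (nbhs x) _ [set x]) x1 => _ ->.
split=> //; have [g piK gK] := pi_bij; exists g; split=> //.
Qed.

Definition perm_system : system := System perm_act_homeo.

End Permutation.

Definition fullshift_times_finite_orbit_perm (X : system) : Prop :=
  exists (A : finType) (D : countType) (pi : D -> D) (pi_bij : bijective pi),
    (forall d, finite_set (zorbit pi d)) /\
    X = prod_system (full_shift A) (perm_system pi_bij).

Definition fullshift_times_wandering_markov (X : system) : Prop :=
  exists (A : finType) (B : countType) (E : set (B * B)),
    essentially_wandering (markov_shift E) /\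
    X = prod_system (full_shift A) (markov_shift E).

Definition conjugate_to_inverse_limit_of (P : system -> Prop)
    (Y : topologicalType) (S : Y -> Y) : Prop :=
  exists (X : nat -> system) (p : forall n, X n.+1 -> X n)
      (p_factor : forall n, factor_map (@p n)),
    (forall n, P (X n)) /\
    topologically_conjugate S (@act (inverse_limit p_factor)).

(* Main.v *)
Require Import Defs.
From mathcomp Require Import all_boot all_order all_algebra.
From mathcomp Require Import all_classical.
From mathcomp Require Import topology.
From mathcomp Require Import zify.

(* For a compact open subgroup V of G let core V be the intersection of the
   T^i V.  As V shrinks to 1, G is the inverse limit of the coset systems
   G / core V, so it suffices to split these for arbitrarily small V.

   Shrinking V, one may assume that V is the product of its elements with past
   in V and of its elements with future in V (Willis's tidiness above).  Then
   every sequence of cosets of V whose consecutive terms are compatible is the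
   itinerary of a point: G / core V is a Markov shift over G / V.  The points
   homoclinic to V form a group with compact closure L, and V can be chosen
   normalized by L.

   Replace V by V1 = (L ∩ T^-1 V) V.  Consecutive coordinates are independent
   in core V1 / core V, so G / core V is the product of G / core V1 and a full
   shift; the product is trivialized by any locally constant labelling of
   cosets, which need not respect the group structure.  An ascending chain of
   open subgroups of the compact set L V stabilizes, so after finitely many
   steps one gets V ⊂ W with core W = L.

   In the Markov shift G / L over G / W a point with bounded orbit is periodic:
   a bounded orbit whose past stays in W lies in L.  If bounded points are dense
   this forces W = L, and G / L is discrete with finite orbits; otherwise G / L
   is essentially wandering. *)

Set Implicit Arguments.
Unset Strict Implicit.
Unset Printing Implicit Defensive.

Import Order.TTheory GRing.Theory Num.Theory.
Local Open Scope classical_set_scope.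
Local Open Scope ring_scope.
Local Open Scope group_scope.

(** * Compactness and total disconnectedness *)

(** Otherwise the traces on [K] of the members of [F] generate a proper filter, and a cluster point
    of it in [K] would lie in every member. *)
Lemma compact_directed (X : topologicalType) (K : set X) (F : set (set X)) :
  compact K -> F !=set0 ->
  (forall A B, F A -> F B -> exists2 C, F C & C `<=` A `&` B) ->
  (forall A, F A -> closed A) ->
  (forall x, K x -> exists2 A, F A & ~ A x) ->
  exists2 A, F A & A `&` K `<=` set0.
Proof.
move=> cK [A0 FA0] Fdir Fcl FK; apply: contrapT => /forall2NP noA.
pose FF := filter_from F (fun A => A `&` K).
have FFf : ProperFilter FF.
  apply: filter_from_proper; first apply: filter_from_filter.
  - by exists A0.
  - move=> A B FA FB; have [C FC CAB] := Fdir _ _ FA FB.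
    by exists C => // x [/CAB[Ax Bx] Kx].
  - move=> A FA; have [//|/existsNP[x /not_implyP[AKx _]]] := noA A.
    by exists x.
have [|x [Kx clx]] := cK FF FFf; first by exists A0 => // x [].
have [A FA nAx] := FK x Kx; apply: nAx; apply: (Fcl A FA) => B nB.
have [|y [[Ay _] By]] := clx (A `&` K) B _ nB; first by exists A.
by exists y.
Qed.

Lemma compact_nested (X : topologicalType) (C : nat -> set X) (O : set X) :
  compact (C 0%N) -> (forall n, closed (C n)) ->
  (forall n, C n.+1 `<=` C n) -> open O ->
  (forall x, (forall n, C n x) -> O x) -> exists n, C n `<=` O.
Proof.
move=> cC0 clC Cdec oO CO.
have Cle m n : (m <= n)%N -> C n `<=` C m.
  move=> /subnK <-; elim: (n - m)%N => // k IH x /=.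
  by rewrite addSn => /Cdec/IH.
have [|||||A [n _ <-] nA] := @compact_directed X (C 0%N `\` O) (range C).
- apply: subclosed_compact cC0 _ => [|x []//].
  by apply: closedI; [exact: clC|exact: open_closedC].
- by exists (C 0%N); exists 0%N.
- move=> _ _ [m _ <-] [n _ <-]; exists (C (maxn m n)); first by exists (maxn m n).
  by move=> x Cx; split; apply: Cle Cx; [exact: leq_maxl|exact: leq_maxr].
- by move=> _ [n _ <-].
- move=> x [_ nOx]; apply: contrapT => /forall2NP nC; apply/nOx/CO => n.
  by have [/(_ (imageT _ _))//|/contrapT] := nC (C n).
exists n => x Cx; apply: contrapT => nOx.
by apply: (nA x); split=> //; split=> //; exact: Cle Cx.
Qed.

Lemma compact_nested_nonempty (X : topologicalType) (C : nat -> set X) :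
  compact (C 0%N) -> (forall n, closed (C n)) ->
  (forall n, C n.+1 `<=` C n) -> (forall n, C n !=set0) ->
  exists x, forall n, C n x.
Proof.
move=> cC0 clC Cdec C0; apply: contrapT => nx.
have [|n nC] := compact_nested cC0 clC Cdec open0.
  by move=> x Cx; apply: nx; exists x.
by have [x /nC] := C0 n.
Qed.

(** Two rounds of [compact_directed]: among closures of neighbourhoods of a point [a] of [A] one
    misses [B]; then among closures of open sets around [B] one misses all of [A]. *)
Lemma compact_separation (X : topologicalType) (A B : set X) :
  hausdorff_space X -> compact A -> compact B -> A `&` B `<=` set0 ->
  exists U V : set X,
    [/\ open U, open V, A `<=` U, B `<=` V & U `&` V `<=` set0].
Proof.
move=> hX cA cB AB.
pose F := [set D | exists O : set X, [/\ open O, B `<=` O & D = closure O]].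
have [||||_ [O [oO BO ->] OA]] := @compact_directed X A F cA.
- by exists (closure setT), setT; split=> //; exact: openT.
- move=> _ _ [O [oO BO ->]] [O' [oO' BO' ->]]; exists (closure (O `&` O')).
    exists (O `&` O'); split=> //; first exact: openI.
    by move=> x Bx; split; [exact: BO|exact: BO'].
  exact: closureI.
- by move=> _ [O [_ _ ->]]; exact: closed_closure.
- move=> a Aa; pose Fa := [set D | exists2 W, nbhs a W & D = closure W].
  have [||||_ [W nW ->] WB] := @compact_directed X B Fa cB.
  + by exists (closure setT), setT => //; exact: filterT.
  + move=> _ _ [W nW ->] [W' nW' ->]; exists (closure (W `&` W')).
      by exists (W `&` W') => //; exact: filterI.
    exact: closureI.
  + by move=> _ [W _ ->]; exact: closed_closure.
  + move=> b Bb; apply: contrapT => nex; apply: (AB a); split=> //.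
    suff -> : a = b by [].
    apply: hX; rewrite clusterE => W nW; apply: contrapT => nWb.
    by apply: nex; exists (closure W) => //; exists W.
  + exists (closure (~` closure W)).
      exists (~` closure W); split=> //.
        exact/closed_openC/closed_closure.
      by move=> b Bb Wb; apply: (WB b).
    by move=> /(_ W nW)[x [nWx Wx]]; apply/nWx/subset_closure.
exists (~` closure O), O; split=> //.
- exact/closed_openC/closed_closure.
- by move=> a Aa Oa; apply: (OA a).
- by move=> x [nOx Ox]; apply/nOx/subset_closure.
Qed.

(** In a compact Hausdorff neighbourhood the quasi-component of [x] is connected, hence equal to
    [{x}]; by compactness some relatively clopen set around [x] then lies in the interiors of [N]
    and [P]. *)
Lemma totally_disconnected_compact_open (X : topologicalType) (N P : set X) x :
  hausdorff_space X -> totally_disconnected [set: X] -> compact N -> nbhs x N ->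
  nbhs x P -> exists D : set X, [/\ open D, compact D, D x & D `<=` P].
Proof.
move=> hX tdX cN nN nP.
have clN : closed N by exact: compact_closed.
(* [F] is the family of relatively clopen subsets of [N] containing [x]; its
   intersection is the quasi-component of [x] in [N]. *)
pose F := [set D : set X | [/\ closed D, closed (N `\` D), D x & D `<=` N]].
have FN : F N.
  split=> //; last exact: nbhs_singleton.
  by rewrite setDv; exact: closed0.
have FI A B : F A -> F B -> F (A `&` B).
  move=> [cA cNA Ax AN] [cB cNB Bx BN]; split=> //; first exact: closedI.
    by rewrite setDIr; exact: closedU.
  by move=> y [/AN].
have Fdir A B : F A -> F B -> exists2 C, F C & C `<=` A `&` B.
  by move=> FA FB; exists (A `&` B) => //; exact: FI.
have Fcl A : F A -> closed A by case.
pose Q := \bigcap_(D in F) D.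
have Qx : Q x by move=> D [].
have QN : Q `<=` N by move=> y /(_ N FN).
have cQ : closed Q by apply: closed_bigI.
have absorb O : open O -> Q `<=` O -> exists2 D, F D & D `<=` O.
  move=> oO QO.
  have [|||D FD nD] := @compact_directed X (N `\` O) F _ _ Fdir Fcl.
  - apply: subclosed_compact cN _ => [|y []//].
    by apply: closedI => //; exact: open_closedC.
  - by exists N.
  - move=> y [Ny nOy]; apply: contrapT => /forall2NP nex; apply/nOy/QO => D FD.
    by have [/(_ FD)//|/contrapT] := nex D.
  - exists D => // y Dy; apply: contrapT => nOy; apply: (nD y); split=> //.
    by split=> //; case: FD => _ _ _; apply.
have conQ : connected Q.
  (* A separation of [Q] extends to disjoint open sets [U] and [V] covering some [D] in [F]; then
     [D ∩ U] is again in [F], so [Q] cannot meet [B]. *)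
  have half A B : closed A -> closed B -> A `<=` Q -> B `<=` Q ->
      Q `<=` A `|` B -> A `&` B `<=` set0 -> A x -> Q `<=` A.
    move=> clA clB AQ BQ QAB AB Ax.
    have cA : compact A by apply: subclosed_compact cN _ => // y /AQ/QN.
    have cB : compact B by apply: subclosed_compact cN _ => // y /BQ/QN.
    have [U [V [oU oV AU BV UV]]] := compact_separation hX cA cB AB.
    have [||D [cD cND Dx DN] DUV] := absorb (U `|` V).
    - exact: openU.
    - by move=> y /QAB[/AU|/BV]; [left|right].
    have DUE : D `&` U = D `&` ~` V.
      apply/seteqP; split=> y [Dy].
        by move=> Uy; split=> // Vy; apply: (UV y).
      by move=> nVy; split=> //; case: (DUV y Dy).
    have FDU : F (D `&` U).
      split=> //.
      - by rewrite DUE; apply: closedI => //; exact: open_closedC.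
      - by rewrite setDIr; apply: closedU => //; apply: closedI => //; exact: open_closedC.
      - by split=> //; exact: AU.
      - by move=> y [/DN].
    move=> y Qy; have [//|By] := QAB y Qy.
    by have [_ Uy] := Qy _ FDU; case: (UV y); split=> //; exact: BV.
  move=> B [b0 Bb0] [O oO BO] [C cC BC].
  have clB : closed B by rewrite BC; exact: closedI.
  have BQ : B `<=` Q by rewrite BO => y [].
  have clQB : closed (Q `\` B).
    have -> : Q `\` B = Q `&` ~` O.
      apply/seteqP; split=> y [Qy].
        by move=> nBy; split=> // Oy; apply: nBy; rewrite BO.
      by move=> nOy; split=> //; rewrite BO => -[].
    by apply: closedI => //; exact: open_closedC.
  have cov : Q `<=` B `|` (Q `\` B).
    by move=> y Qy; have [By|nBy] := pselect (B y); [left|right].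
  apply/seteqP; split=> //.
  have [Bx|nBx] := pselect (B x).
    by apply: (half B (Q `\` B)) => // y [By []].
  have /(_ b0 (BQ _ Bb0))[_ //] : Q `<=` Q `\` B.
  apply: (half (Q `\` B) B) => // [y /cov[]|y [[]]//]; by [right|left].
have QE : Q `<=` [set x].
  have <- := tdX x I; exact: (connected_component_max Qx).
have [||D [cD cND Dx DN] DN'] := absorb (N° `&` P°).
- by apply: openI; exact: open_interior.
- by move=> y /QE ->.
exists D; split=> //; first 1 last.
- exact: subclosed_compact cN _.
- by move=> y /DN'[_ /interior_subset].
have -> : D = N° `&` ~` (N `\` D).
  apply/seteqP; split=> y.
    by move=> Dy; split; [case: (DN' y Dy)|move=> []].
  move=> [/interior_subset Ny nND]; apply: contrapT => nDy.
  exact: nND.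
by apply: openI; [exact: open_interior|exact: closed_openC].
Qed.

(** Near [y] all preimages under [f] lie in a compact [K], so the points of [U] that [g] sends into
    a given closed set come from a compact part of [K] and form a relatively closed set. This serves
    for the bonding maps and for the inverse of the conjugacy. *)
Lemma continuous_of_proper_surjection (X Y Z : topologicalType) (f : X -> Y)
    (g : Y -> Z) :
  hausdorff_space Y -> continuous f -> (forall y, exists x, f x = y) ->
  (forall y, exists2 K : set X, compact K & exists U : set Y,
    [/\ open U, U y & f @^-1` U `<=` K]) ->
  continuous (g \o f) -> continuous g.
Proof.
move=> hY cf sf pf cgf y O; rewrite nbhsE /= => -[O' [oO' O'y] O'O].
have [K cK [U [oU Uy UK]]] := pf y.
pose M := f @` (K `&` (g \o f) @^-1` ~` O').
have clM : closed M.
  apply: compact_closed => //; apply: continuous_compact.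
    exact: continuous_subspaceT.
  apply: compact_closedI => //; apply: preimage_closed; first by move=> ? _; exact: cgf.
  exact: open_closedC.
suff : nbhs y (g @^-1` O) by [].
rewrite nbhsE; exists (U `&` ~` M) => [|z [Uz nMz]] /=.
  split; first by apply: openI => //; exact: closed_openC.
  by split=> // -[x [_ nO'] fx]; apply: nO'; rewrite /= fx.
apply: O'O; apply: contrapT => nO'; apply: nMz.
have [x fx] := sf z; exists x => //; split; last by rewrite /= fx.
by apply: UK; rewrite /= fx.
Qed.

(** * Totally disconnected locally compact groups *)

Definition locally_constant (X : topologicalType) (A : Type) (f : X -> A) :=
  forall x, \forall y \near x, f y = f x.

Lemma locally_constant_open (X : topologicalType) (A : Type) (f : X -> A)
    (P : set A) :
  locally_constant f -> open (f @^-1` P).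
Proof. by move=> lf; rewrite openE => x Px; apply: filterS (lf x) => y /= ->. Qed.

Lemma locally_constant_closed (X : topologicalType) (A : Type) (f : X -> A)
    (P : set A) :
  locally_constant f -> closed (f @^-1` P).
Proof.
move=> lf; have -> : f @^-1` P = ~` (f @^-1` ~` P).
  by apply/seteqP; split=> x /=; [move=> ? []|move/contrapT].
by apply: open_closedC; exact: locally_constant_open.
Qed.

Lemma locally_constant_continuous (X : topologicalType) (A : choiceType)
    (f : X -> A) :
  locally_constant f -> continuous (f : X -> discrete_topology A).
Proof.
move=> lf x U /nbhs_singleton Ufx; suff : nbhs x (f @^-1` U) by [].
by apply: filterS (lf x) => y /= ->.
Qed.

Lemma compact_locally_constant_bounded (X : topologicalType) (c : X -> nat)
    (K : set X) :
  hausdorff_space X -> locally_constant c -> compact K ->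
  exists n, forall x, K x -> (c x < n)%N.
Proof.
move=> hX lc cK; pose C n := K `&` c @^-1` [set k | (n <= k)%N].
have clK : closed K by exact: compact_closed.
have clC n : closed (C n) by apply: closedI => //; exact: locally_constant_closed.
have [||x Cx|n nC] := compact_nested _ clC _ open0.
- by apply: subclosed_compact cK _ => // x [].
- by move=> n x [Kx /ltnW].
- by have [_] := Cx (c x).+1; rewrite /= ltnn.
- by exists n => x Kx; rewrite ltnNge; apply/negP => ?; apply: (nC x).
Qed.

Lemma open_preimage (X Y : topologicalType) (f : X -> Y) (O : set Y) :
  continuous f -> open O -> open (f @^-1` O).
Proof. by move=> /continuousP; apply. Qed.

Lemma closed_preimage (X Y : topologicalType) (f : X -> Y) (O : set Y) :
  continuous f -> closed O -> closed (f @^-1` O).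
Proof. by move=> cf; apply: preimage_closed => x _; exact: cf. Qed.

Lemma compact_image (X Y : topologicalType) (f : X -> Y) (K : set X) :
  continuous f -> compact K -> compact (f @` K).
Proof. by move=> cf; apply: continuous_compact; exact: continuous_subspaceT. Qed.

Lemma pair_continuous (X Y Z : topologicalType) (f : X -> Y) (g : X -> Z) :
  continuous f -> continuous g -> continuous (fun x => (f x, g x)).
Proof. by move=> cf cg x; apply: cvg_pair; [exact: cf|exact: cg]. Qed.

Definition subgroup (G : groupType) (V : set G) :=
  [/\ V 1, (forall x y, V x -> V y -> V (x * y)) & forall x, V x -> V x^-1].

Section SubgroupTheory.
Variables (G : groupType) (V : set G).
Hypothesis sV : subgroup V.

Lemma subg1 : V 1. Proof. by case: sV. Qed.
Lemma subgM x y : V x -> V y -> V (x * y). Proof. by case: sV => _ + _; apply. Qed.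
Lemma subgV x : V x -> V x^-1. Proof. by case: sV => _ _; exact. Qed.

Lemma subgMl x y : V x -> V (x * y) <-> V y.
Proof.
by move=> Vx; split=> [/(subgM (subgV Vx))|/(subgM Vx)//]; rewrite mulKg.
Qed.

Lemma coset_refl x : V (x^-1 * x). Proof. by rewrite mulVg; exact: subg1. Qed.

Lemma coset_sym x y : V (x^-1 * y) -> V (y^-1 * x).
Proof. by move=> /subgV; rewrite invgM invgK. Qed.

Lemma coset_trans y x z : V (x^-1 * y) -> V (y^-1 * z) -> V (x^-1 * z).
Proof. by move=> /subgM/[apply]; rewrite mulgA mulgK. Qed.

Lemma coset_mem x y : V x -> V (x^-1 * y) -> V y.
Proof. by move=> Vx /(subgM Vx); rewrite mulVKg. Qed.

End SubgroupTheory.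

Section TopologicalGroups.
Variable G : topologicalGroupType.
Implicit Types (x y g : G) (U V K : set G).

Lemma mulg_continuousl g : continuous (fun x : G => g * x).
Proof.
move=> x; apply: (@continuous_comp _ _ _ (fun x : G => (g, x)) (fun p => p.1 * p.2)).
  by apply: cvg_pair => //=; exact: cvg_cst.
exact: mulg_continuous.
Qed.

Lemma mulg_continuousr g : continuous (fun x : G => x * g).
Proof.
move=> x; apply: (@continuous_comp _ _ _ (fun x : G => (x, g)) (fun p => p.1 * p.2)).
  by apply: cvg_pair => //=; exact: cvg_cst.
exact: mulg_continuous.
Qed.

Lemma nbhs_coset x V : nbhs 1 V -> nbhs x [set y | V (x^-1 * y)].
Proof. by move=> nV; apply: mulg_continuousl; rewrite mulVg. Qed.

Lemma nbhs1_translate x V : nbhs x V -> nbhs 1 [set y | V (x * y)].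
Proof. by move=> nV; apply: mulg_continuousl; rewrite mulg1. Qed.

Lemma compact_coset g V : compact V -> compact [set x | V (g^-1 * x)].
Proof.
move=> /(compact_image (@mulg_continuousl g)); congr compact.
by apply/seteqP; split=> [_ [x Vx <-]|x Vx] /=;
  [rewrite mulKg|exists (g^-1 * x); rewrite ?mulVKg].
Qed.

Definition mulset U V : set G := [set x * y | x in U & y in V].

Lemma compact_mulset U V : compact U -> compact V -> compact (mulset U V).
Proof.
move=> cU cV; have := compact_image (@mulg_continuous G) (compact_setX cU cV).
congr compact; apply/seteqP; split.
  by move=> _ [[x y] [/= Ux Vy] <-]; exists x => //; exists y.
by move=> _ [x Ux [y Vy <-]]; exists (x, y).
Qed.

Lemma nbhs1_open_subgroup V : subgroup V -> nbhs 1 V -> open V.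
Proof.
move=> sV nV; rewrite openE => x Vx; apply: filterS (nbhs_coset x nV) => y /=.
by move/(subgM sV Vx); rewrite mulVKg.
Qed.

Lemma coset_code_locally_constant (A : Type) (c : G -> A) V :
  (forall x y, c x = c y <-> V (x^-1 * y)) -> nbhs 1 V -> locally_constant c.
Proof.
move=> cP nV x; apply: filterS (nbhs_coset x nV) => y /=.
by move/cP.
Qed.

Lemma open_subgroup_closed V : subgroup V -> open V -> closed V.
Proof.
move=> sV oV; rewrite -[V]setCK; apply/open_closedC; rewrite openE => x nVx.
have nV : nbhs 1 V by apply: open_nbhs_nbhs; split=> //; exact: subg1.
apply: filterS (nbhs_coset x nV) => y /= Vxy Vy; apply: nVx.
by rewrite -(mulVKg y x); exact: (subgM sV Vy (coset_sym sV Vxy)).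
Qed.

Hypothesis hG : hausdorff_space G.

Definition compact_open_subgroup V := [/\ subgroup V, open V & compact V].

Lemma compact_open_subgroup_closed V : compact_open_subgroup V -> closed V.
Proof. by case=> sV oV _; exact: open_subgroup_closed. Qed.

Lemma compact_open_subgroup_nbhs V : compact_open_subgroup V -> nbhs 1 V.
Proof. by case=> sV oV _; apply: open_nbhs_nbhs; split=> //; exact: subg1. Qed.

Hypothesis lcG : locally_compact [set: G].
Hypothesis tdG : totally_disconnected [set: G].

Lemma compact_open_basis x U : nbhs x U ->
  exists D : set G, [/\ open D, compact D, D x & D `<=` U].
Proof.
move=> nU; have [N nN [cN _]] := lcG (I : [set: G] x).
apply: totally_disconnected_compact_open cN _ nU => //.
by rewrite -[nbhs x]withinET; exact: nN.
Qed.

(** [V] is the right stabilizer of a compact open [D] inside [U] that contains 1. It is a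
    neighbourhood of 1 because the condition that [d * x] is in [D] is open, uniformly over the
    compact [D]. *)
Theorem van_dantzig U : nbhs 1 U ->
  exists2 V, compact_open_subgroup V & V `<=` U.
Proof.
move=> /compact_open_basis[D [oD cD D1 DU]].
have clD : closed D by exact: compact_closed.
pose V := [set x : G | forall d, D d <-> D (d * x)].
have sV : subgroup V.
  split=> [d|x y Vx Vy d|x Vx d]; first by rewrite mulg1.
    by rewrite mulgA; exact: iff_trans (Vx d) (Vy (d * x)).
  by have := Vx (d * x^-1); rewrite mulgVK => ->.
have VD : V `<=` D by move=> x /(_ 1)[/(_ D1)]; rewrite mul1g.
have nDx : \forall x \near (1 : G), forall d, D d -> D (d * x).
  have /compact_near_coveringP/(_ _ (nbhs (1 : G)) (fun x d => D (d * x))) := cD.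
  apply=> d Dd; apply: (@mulg_continuous G (d, 1)) => /=.
  by rewrite mulg1; exact: open_nbhs_nbhs.
have nDV : \forall x \near (1 : G), forall d, D d -> D (d * x^-1).
  by have := @invg_continuous G 1; rewrite /continuous_at invg1 => /(_ _ nDx).
have nV : nbhs 1 V.
  apply: filterS2 nDx nDV => x Dx DVx d; split=> [/Dx//|/DVx].
  by rewrite mulgK.
have oV : open V by exact: nbhs1_open_subgroup.
exists V => [|x /VD/DU//]; split=> //.
by apply: subclosed_compact cD _ => //; exact: open_subgroup_closed.
Qed.

Hypothesis scG : @second_countable G.

(** Each coset of [V] is open, so it contains a nonempty member of the countable basis, and the
    number of a chosen one is the code. The choice depends on the set [S x] only, hence on the coset
    only. *)
Lemma coset_code V : subgroup V -> open V ->
  exists c : G -> nat, forall x y, c x = c y <-> V (x^-1 * y).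
Proof.
move=> sV oV; have [B cB [oB bB]] := scG.
have /countable_injP[f fI] := cB.
pose S x := [set W : set G | [/\ B W, W !=set0 & W `<=` [set y | V (x^-1 * y)]]].
have nV : nbhs 1 V by apply: open_nbhs_nbhs; split=> //; exact: subg1.
have getS x : S x (get (S x)).
  apply: getPex; have [W [BW Wx] WV] := bB x _ (nbhs_coset x nV).
  by exists W; split=> //; exists x.
exists (fun x => f (get (S x))) => x y; split=> [/fI E|Vxy]; last first.
  have -> // : S x = S y.
  apply/seteqP; split=> W [BW W0 WV]; split=> // z /WV /=.
    exact: coset_trans (coset_sym sV Vxy).
  exact: coset_trans Vxy.
have [Bx [z Sz] Sx] := getS x; have [By _ Sy] := getS y.
have {}E : get (S x) = get (S y) by apply: E; rewrite inE.
by apply: coset_trans (Sx z Sz) (coset_sym sV (Sy z _)) => //; rewrite -E.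
Qed.

(** A Baire category argument: the countably many compact sets [T(g V)] cover [G]. If none contained
    a nonempty open set, nested compact open sets could avoid them one after the other and still
    have a common point. *)
Theorem inverse_automorphism_continuous (T Ti : G -> G) :
  continuous T -> {morph T : x y / x * y} -> cancel T Ti -> cancel Ti T ->
  continuous Ti.
Proof.
move=> cT TM TK TiK.
have TiM : {morph Ti : x y / x * y}.
  by move=> x y; apply: (can_inj TK); rewrite TM !TiK.
have Ti1 : Ti 1 = 1 by apply: (mulgI (Ti 1)); rewrite -TiM !mulg1.
suff n1 V : compact_open_subgroup V -> nbhs 1 (Ti @^-1` V).
  move=> x U nU; have [V cV VU] := van_dantzig (nbhs1_translate nU).
  suff : nbhs x (Ti @^-1` U) by [].
  apply: filterS (nbhs_coset x (n1 V cV)) => y /= /VU /=.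
  by rewrite -TiM mulVKg.
move=> cosV; have [sV oV cV] := cosV; apply: contrapT => nTV.
have [c cP] := coset_code sV oV.
pose K n := [set y | c (Ti y) = n].
have cK n : compact (K n).
  have [[g cg]|nog] := pselect (exists g, c g = n); last first.
    have -> : K n = set0; last exact: compact0.
    by apply/seteqP; split=> // y Ky; apply: nog; exists (Ti y).
  have := compact_image cT (@compact_coset g V cV); congr compact.
  apply/seteqP; split=> [_ [x Vx <-]|y]; first by rewrite /K /= TK -cg; apply/esym/cP.
  by rewrite /K /= -cg => /esym/cP Vy; exists (Ti y).
have noO n O : open O -> O !=set0 -> exists y, O y /\ ~ K n y.
  move=> oO [y Oy]; apply: contrapT => nex; apply: nTV.
  have OK z : O z -> K n z.
    by move=> Oz; apply: contrapT => nKz; apply: nex; exists z.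
  have := nbhs1_translate (open_nbhs_nbhs (conj oO Oy)); apply: filterS => z /=.
  move/OK; rewrite /K /= => cz; have {cz} : c (Ti y) = c (Ti (y * z)).
    by rewrite cz; exact: OK.
  by move/cP; rewrite TiM mulKg.
pose good (D : set G) := [/\ open D, compact D & D !=set0].
have step (nD : nat * set G) : exists D' : set G, good nD.2 ->
    [/\ good D', D' `<=` nD.2 & forall y, D' y -> ~ K nD.1 y].
  case: nD => n D /=; have [gD|ngD] := pselect (good D); last by exists D.
  have [oD cD D0] := gD; have [y [Dy nKy]] := noO n D oD D0.
  have [|D' [oD' cD' D'y D'D]] := @compact_open_basis y (D `&` ~` K n).
    apply: open_nbhs_nbhs; split=> //; apply: openI => //.
    by apply: closed_openC; apply: compact_closed hG (cK n).
  exists D' => _; split=> [|z /D'D[]//|z /D'D[]//].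
  by split=> //; exists y.
have [h hP] := choice step.
have [D0 [oD0 cD0 D01 _]] := @compact_open_basis 1 setT filterT.
pose D := fix D n := if n is m.+1 then h (m, D m) else D0.
have gD n : good (D n).
  by elim: n => [|n IH] /=; [split=> //; exists 1|have [] := hP (n, D n) IH].
have [||||x Dx] := @compact_nested_nonempty _ D.
- exact: cD0.
- by move=> n; apply: compact_closed => //; case: (gD n).
- by move=> n; have [] := hP (n, D n) (gD n).
- by move=> n; case: (gD n).
pose n := c (Ti x); have [_ _ avoid] := hP (n, D n) (gD n).
exact: (avoid x (Dx n.+1)).
Qed.

End TopologicalGroups.

(** * Orbits and tidy subgroups *)

Lemma nat_pigeonhole (f : nat -> nat) B : (forall n, (f n < B)%N) ->
  exists k, forall N, exists2 n, (N <= n)%N & f n = k.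
Proof.
move=> fB; apply: contrapT => /forallNP nk.
have bound b : exists N, forall n, (N <= n)%N -> (b <= f n)%N.
  elim: b => [|b [N Nb]]; first by exists 0%N.
  have /existsNP[N' N'b] := nk b.
  exists (maxn N N') => n; rewrite geq_max => /andP[/Nb bn N'n].
  rewrite ltn_neqAle bn andbT; apply/eqP => E.
  by apply: N'b; exists n.
have [N NB] := bound B; have := NB N (leqnn N).
by rewrite leqNgt fB.
Qed.

Record automorphism (G : topologicalGroupType) := Automorphism {
  aut :> G -> G;
  aut_inv : G -> G;
  aut_continuous : continuous aut;
  aut_inv_continuous : continuous aut_inv;
  autM : {morph aut : x y / x * y};
  autK : cancel aut aut_inv;
  aut_invK : cancel aut_inv aut
}.

Section Iterates.
Variables (G : topologicalGroupType) (T : automorphism G).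
Implicit Types (x y : G) (U V W : set G).
Local Notation Ti := (aut_inv T).
Let cT := @aut_continuous _ T.
Let cTi := @aut_inv_continuous _ T.
Let TM := @autM _ T.
Let TK := @autK _ T.
Let TiK := @aut_invK _ T.

Definition ziter (i : int) (x : G) : G :=
  match i with Posz n => iter n T x | Negz n => iter n.+1 Ti x end.

Lemma ziter0 x : ziter 0 x = x. Proof. by []. Qed.
Lemma ziter1 x : ziter 1%R x = T x. Proof. by []. Qed.

Lemma ziterS i x : ziter (i + 1%R) x = T (ziter i x).
Proof.
case: i => [n|[|n]].
- by rewrite -PoszD addn1.
- by rewrite /= TiK.
- have -> : Negz n.+1 + 1%R = Negz n by lia.
  by rewrite /= TiK.
Qed.

Lemma ziterP i x : ziter (i - 1%R) x = Ti (ziter i x).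
Proof. by rewrite -[i in RHS](subrK 1%R) ziterS TK. Qed.

Lemma ziterD i j x : ziter (i + j) x = ziter i (ziter j x).
Proof.
elim/int_rect: i => [|n IH|n IH]; first by rewrite add0r.
  by rewrite -addn1 PoszD -addrA [1%R + j]addrC addrA !ziterS IH.
have -> : (- n.+1%:Z) = - n%:Z - 1%R by lia.
by rewrite addrAC !ziterP IH.
Qed.

Lemma ziterNK i x : ziter (- i) (ziter i x) = x.
Proof. by rewrite -ziterD addNr. Qed.

Lemma ziterKN i x : ziter i (ziter (- i) x) = x.
Proof. by rewrite -ziterD subrr. Qed.

Lemma ziterM i : {morph ziter i : x y / x * y}.
Proof.
have TiM : {morph Ti : x y / x * y}.
  by move=> x y; apply: (can_inj TK); rewrite TM !TiK.
move=> x y; elim/int_rect: i => [//|n IH|n IH].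
  by rewrite -addn1 PoszD !ziterS IH.
have -> : (- n.+1%:Z) = - n%:Z - 1%R by lia.
by rewrite !ziterP IH.
Qed.

Lemma ziterG1 i : ziter i 1 = 1.
Proof. by apply: (mulgI (ziter i 1)); rewrite -ziterM !mulg1. Qed.

Lemma ziterV i x : ziter i x^-1 = (ziter i x)^-1.
Proof. by apply: (mulgI (ziter i x)); rewrite -ziterM !mulgV ziterG1. Qed.

Lemma aut_invg x : T x^-1 = (T x)^-1.
Proof. exact: (ziterV 1%R). Qed.

Lemma ziter_continuous i : continuous (ziter i).
Proof.
elim/int_rect: i => [|n IH|n IH].
- by move=> x; exact: cvg_id.
- rewrite (_ : ziter n.+1 = T \o ziter n) => [|//].
  by move=> x; apply: continuous_comp; [exact: IH|exact: cT].
- rewrite (_ : ziter (- n.+1%:Z) = Ti \o ziter (- n%:Z)).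
    by move=> x; apply: continuous_comp; [exact: IH|exact: cTi].
  apply/funext => x; have -> : - n.+1%:Z = - n%:Z - 1%R by lia.
  exact: ziterP.
Qed.

Lemma zorbitP x y : zorbit T x y <-> exists i, y = ziter i x.
Proof.
split=> [[n [->|<-]]|[[n|n] ->]].
- by exists n.
- by exists (- n%:Z); rewrite -[iter n T y]/(ziter n y) ziterNK.
- by exists n; left.
- exists n.+1; right; rewrite -[iter _ _ _]/(ziter n.+1 (ziter (Negz n) x)).
  by rewrite -ziterD; have -> : n.+1%:Z + Negz n = 0 by lia.
Qed.

Definition core (V : set G) : set G := [set x | forall i : int, V (ziter i x)].

Definition homoclinic (V : set G) : set G :=
  [set x | exists n : nat, forall i : int, (n <= absz i)%N -> V (ziter i x)].

(* For a compact open subgroup, this is equivalent to Willis's tidiness above,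
   [V = V_+ V_-]; see [splice]. *)
Definition tidy (V : set G) := forall v, V v -> exists a b,
  [/\ v = a * b, forall n : nat, V (ziter (- n%:Z) a), V b & V (T b)].

Definition past_core (V : set G) (n : nat) : set G :=
  [set x | forall k : nat, (k <= n)%N -> V (ziter (- k%:Z) x)].

Lemma ziter_preimage_closed (V : set G) (P : set int) (g : int -> G) :
  closed V -> closed [set x | forall i, P i -> V (g i * ziter i x)].
Proof.
move=> cV.
apply: (@closed_bigI _ _ P (fun i => (fun x => g i * ziter i x) @^-1` V)) => i _.
apply: closed_preimage cV => x.
apply: (@continuous_comp _ _ _ (ziter i)); first exact: ziter_continuous.
exact: mulg_continuousl.
Qed.

Lemma core_closed (V : set G) : closed V -> closed (core V).
Proof.
move=> /(@ziter_preimage_closed V setT (fun=> 1)); congr closed.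
apply/seteqP; split=> x Vx i => [|_]; last by rewrite mul1g; exact: Vx.
by have := Vx i I; rewrite mul1g.
Qed.

Section SubgroupDynamics.
Variable V : set G.
Hypothesis sV : subgroup V.

Lemma past_core_subgroup n : subgroup (past_core V n).
Proof.
split=> [k _|x y Vx Vy k kn|x Vx k kn].
- by rewrite ziterG1; exact: subg1.
- by rewrite ziterM; apply: subgM => //; [exact: Vx|exact: Vy].
- by rewrite ziterV; apply: subgV => //; exact: Vx.
Qed.

Lemma core_subgroup : subgroup (core V).
Proof.
split=> [k|x y Vx Vy k|x Vx k].
- by rewrite ziterG1; exact: subg1.
- by rewrite ziterM; apply: subgM.
- by rewrite ziterV; apply: subgV => //; exact: Vx.
Qed.

Lemma homoclinic_subgroup : subgroup (homoclinic V).
Proof.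
split=> [|x y [n Vx] [m Vy]|x [n Vx]].
- by exists 0%N => i _; rewrite ziterG1; exact: subg1.
- exists (maxn n m) => i; rewrite geq_max => /andP[ni mi].
  by rewrite ziterM; apply: subgM => //; [exact: Vx|exact: Vy].
- by exists n => i ni; rewrite ziterV; apply: subgV => //; exact: Vx.
Qed.

Lemma core_homoclinic : core V `<=` homoclinic V.
Proof. by move=> x Vx; exists 0%N. Qed.

Lemma core_ziter j x : core V x -> core V (ziter j x).
Proof. by move=> Vx i; rewrite -ziterD. Qed.

Lemma homoclinic_ziter j x : homoclinic V x -> homoclinic V (ziter j x).
Proof. by case=> n Vx; exists (n + absz j)%N => i ni; rewrite -ziterD; apply: Vx; lia. Qed.

End SubgroupDynamics.

Lemma closure_subgroup (S : set G) : subgroup S -> subgroup (closure S).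
Proof.
move=> sS; split=> [|x y Sx Sy U nU|x Sx U nU].
- by apply: subset_closure; exact: subg1.
- have [[A B] /= [nA nB] ABU] := @mulg_continuous G (x, y) U nU.
  have [a [Sa Aa]] := Sx A nA; have [b [Sb Bb]] := Sy B nB.
  by exists (a * b); split; [exact: subgM|exact: (ABU (a, b))].
- have [a [Sa Ua]] := Sx _ (@invg_continuous G x U nU).
  by exists a^-1; split=> //; exact: subgV.
Qed.

Lemma closure_ziter (S : set G) j x : (forall y, S y -> S (ziter j y)) ->
  closure S x -> closure S (ziter j x).
Proof.
move=> Sj Sx U nU; have [a [Sa Ua]] := Sx _ (@ziter_continuous j x U nU).
by exists (ziter j a); split=> //; exact: Sj.
Qed.

Lemma homoclinicS (V W : set G) : V `<=` W -> homoclinic V `<=` homoclinic W.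
Proof. by move=> VW x [n Vx]; exists n => i ni; exact/VW/Vx. Qed.

Lemma past_core_compact_open_subgroup (V : set G) n :
  compact_open_subgroup V -> compact_open_subgroup (past_core V n).
Proof.
move=> cosV; have [sV oV cV] := cosV.
have sP := past_core_subgroup sV n; have oP : open (past_core V n).
  elim: n {sP} => [|n IH].
    rewrite (_ : past_core V 0 = V)//; apply/seteqP; split=> x.
      by move/(_ 0%N (leqnn _)).
    by move=> Vx k; rewrite leqn0 => /eqP ->.
  rewrite (_ : past_core V n.+1 =
    past_core V n `&` ziter (- n.+1%:Z) @^-1` V).
    by apply: openI => //; apply: open_preimage oV; exact: ziter_continuous.
  apply/seteqP; split=> x /=.
    by move=> Vx; split=> [k /leqW/Vx//|]; exact: (Vx n.+1 (leqnn _)).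
  by move=> [Vx Vn] k; rewrite leq_eqVlt ltnS => /orP[/eqP ->|/Vx].
split=> //; apply: subclosed_compact cV _; first exact: open_subgroup_closed.
by move=> x /(_ 0%N (leq0n _)).
Qed.

(* With [U_+ = \bigcap_(k >= 0) T^k U], the open set [T(U_+) U] contains
   [T(U_+)], hence contains [T(past_core U n)] as soon as [n] is large. *)
Lemma exists_tidy (U : set G) : compact_open_subgroup U ->
  exists n, tidy (past_core U n).
Proof.
move=> cosU; have [sU oU cU] := cosU; have clU := compact_open_subgroup_closed cosU.
(* The exponent [k.+1] makes [C n] equal to [T(past_core U n)]; the set [O] below is [T(U_+) U]. *)
pose C n := [set x | forall k : nat, (k <= n)%N -> U (ziter (- k.+1%:Z) x)].
have clC n : closed (C n).
  apply: (@closed_bigI _ _ [set k | (k <= n)%N]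
    (fun k => ziter (- k.+1%:Z) @^-1` U)) => k _.
  by apply: closed_preimage clU; exact: ziter_continuous.
pose O := [set x | exists2 a, (forall k : nat, U (ziter (- k.+1%:Z) a)) & U (a^-1 * x)].
have [|||||n CO] := @compact_nested _ C O.
- apply: (subclosed_compact (clC _) (compact_image cT cU)) => x /(_ 0%N isT) Ux.
  by exists (Ti x) => //; rewrite TiK.
- by [].
- by move=> n x Cx k kn; apply: Cx; exact: leqW.
- rewrite openE => x [a Ua Uax].
  apply: filterS (nbhs_coset x (compact_open_subgroup_nbhs cosU)) => y Uxy.
  by exists a => //; exact: coset_trans Uxy.
- by move=> x Cx; exists x; [move=> k; exact: (Cx k)|exact: coset_refl].
exists n => v Uv.
have [k kn|a Ua Uav] := CO (T v).
  by rewrite -ziter1 -ziterD (_ : _ + _ = - k%:Z)%R; [exact: Uv|lia].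
have TiE x : Ti x = ziter (- 1%R) x by [].
have Ua' (k : nat) : U (ziter (- k%:Z) (Ti a)).
  by rewrite TiE -ziterD (_ : _ + _ = - k.+1%:Z)%R; [exact: Ua|lia].
have Pb : past_core U n ((Ti a)^-1 * v).
  by apply: (subgM (past_core_subgroup sU n)) Uv;
    apply: (subgV (past_core_subgroup sU n)).
exists (Ti a), ((Ti a)^-1 * v); split=> //.
- by rewrite mulVKg.
- move=> m k _; rewrite -ziterD (_ : _ + _ = - (k + m)%:Z)%R; first exact: Ua'.
  lia.
- have -> : T ((Ti a)^-1 * v) = a^-1 * T v.
    by rewrite TM aut_invg TiK.
  case=> [|k] kn; first exact: Uav.
  have -> : a^-1 * T v = ziter 1%R ((Ti a)^-1 * v).
    by rewrite ziterM ziterV !ziter1 TiK.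
  rewrite -ziterD (_ : _ + _ = - k%:Z)%R; last lia.
  by apply: Pb; exact: ltnW.
Qed.

(** Induction on [n]. Split [(T^n x)^-1 y = a b] as in [tidy]. Multiplying [x] by [T^-n a] keeps the
    earlier cosets, since [a] has its past in [V], and moves [T^n x] to [y b^-1], whose image
    [T y (T b)^-1] is in the next coset. *)
Lemma realize_finite_path (V : set G) (g : nat -> G) n :
  subgroup V -> tidy V ->
  (forall i, exists2 y, V ((g i)^-1 * y) & V ((g i.+1)^-1 * T y)) ->
  exists x, forall i : nat, (i <= n)%N -> V ((g i)^-1 * ziter i x).
Proof.
move=> sV tV gP; elim: n => [|n [x xP]].
  by exists (g 0%N) => i; rewrite leqn0 => /eqP ->; exact: coset_refl.
have [y Vy VTy] := gP n.
have [a [b [E Va Vb VTb]]] := tV _ (coset_trans sV (coset_sym sV (xP n (leqnn n))) Vy).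
exists (x * ziter (- n%:Z) a) => i.
rewrite leq_eqVlt ltnS => /orP[/eqP ->|lein]; last first.
  rewrite ziterM mulgA -ziterD (_ : _ + _ = - (n - i)%:Z)%R; last lia.
  by apply: subgM => //; exact: xP.
have -> : ziter n.+1 (x * ziter (- n%:Z) a) = T y * (T b)^-1.
  rewrite -addn1 PoszD ziterS ziterM ziterKN.
  have -> : T (ziter n x * a) = T (y * b^-1).
    by congr (T _); rewrite -(mulVKg (ziter n x) y) E -!mulgA mulgV mulg1.
  by rewrite TM aut_invg.
by rewrite mulgA; apply: subgM => //; exact: subgV.
Qed.

(** Finite paths are realized on every window from [-n] to [n], and compactness of the coset at time
    0 provides a common point. *)
Lemma realize_path (V : set G) (g : int -> G) :
  compact_open_subgroup V -> tidy V ->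
  (forall i, exists2 y, V ((g i)^-1 * y) & V ((g (i + 1%R))^-1 * T y)) ->
  exists x, forall i, V ((g i)^-1 * ziter i x).
Proof.
move=> cosV tV gP; have [sV oV cV] := cosV; have clV := compact_open_subgroup_closed cosV.
pose C (n : nat) := [set x | forall i : int, (absz i <= n)%N -> V ((g i)^-1 * ziter i x)].
have clC n : closed (C n) by exact: ziter_preimage_closed.
have [||||x Cx] := @compact_nested_nonempty _ C.
- have c0 := @compact_coset G (g 0) V cV.
  by apply: (subclosed_compact (clC 0%N) c0) => x /(_ 0 isT); rewrite ziter0.
- by [].
- by move=> n x Cx i i_n; apply: Cx; exact: leqW.
- move=> n; have [k|x xP] := @realize_finite_path V (fun k => g (k%:Z - n%:Z)) (n + n) sV tV.
    have [y Vy VTy] := gP (k%:Z - n%:Z); exists y => //.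
    by rewrite (_ : k.+1%:Z - n%:Z = k%:Z - n%:Z + 1%R)//; lia.
  exists (ziter n x) => i i_n; have := xP (absz (i + n%:Z)).
  rewrite -ziterD (_ : (absz (i + n%:Z))%:Z = i + n)%R; last lia.
  rewrite addrK; apply; lia.
- by exists x => i; exact: (Cx (absz i)).
Qed.

(** The path that follows [x] at negative times and [y] from time 0 on is realizable: its only new
    transition, from -1 to 0, is legal by [V (x^-1 * y)]. *)
Lemma splice (V : set G) x y :
  compact_open_subgroup V -> tidy V -> V (x^-1 * y) ->
  exists s, (forall n : nat, V ((ziter (- n%:Z) x)^-1 * ziter (- n%:Z) s)) /\
            (forall n : nat, V ((ziter n y)^-1 * ziter n s)).
Proof.
move=> cosV tV Vxy; have [sV _ _] := cosV.
have [i|s sP] := @realize_path V (fun i => if (i < 0)%R then ziter i x else ziter i y) cosV tV.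
  have [i0|i0] := ltP i 0; last first.
    exists (ziter i y); first exact: coset_refl.
    rewrite ltNge (_ : (0 <= i + 1)%R = true); last lia.
    by rewrite -ziterS; exact: coset_refl.
  exists (ziter i x); first exact: coset_refl.
  rewrite -ziterS; have [i1|i1] := ltP; first exact: coset_refl.
  have -> : i + 1%R = 0 by lia.
  exact: coset_sym Vxy.
exists s; split=> n; last by have := sP n; rewrite ltNge le0z_nat.
have := sP (- n%:Z); case: ltP => // n0.
have -> : n = 0%N by lia.
by rewrite oppr0 !ziter0; exact: coset_trans.
Qed.

End Iterates.

(** * Homoclinic points *)

Section HomoclinicClosure.
Variables (G : topologicalGroupType) (T : automorphism G).
Implicit Types (x y : G) (U V W Q : set G).
Local Notation it := (ziter T).

Hypothesis hG : hausdorff_space G.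
Hypothesis scG : @second_countable G.

Lemma window_absorb V (O : set G) : compact_open_subgroup V -> open O ->
  core T V `<=` O ->
  exists n : nat, forall x, (forall i, (absz i <= n)%N -> V (it i x)) -> O x.
Proof.
move=> cosV oO VO; have [sV _ cV] := cosV; have clV := compact_open_subgroup_closed cosV.
pose C (n : nat) := [set x | forall i : int, (absz i <= n)%N -> V (it i x)].
have clC n : closed (C n).
  have := @ziter_preimage_closed _ T V [set i : int | (absz i <= n)%N] (fun=> 1) clV.
  congr closed; apply/seteqP; split=> x Cx i i_n; have := Cx i i_n; by rewrite mul1g.
have [|||n nC] := @compact_nested _ C O _ clC _ oO.
- by apply: (subclosed_compact (clC 0%N) cV) => x /(_ 0 isT).
- by move=> n x Cx i i_n; apply: Cx; exact: leqW.
- by move=> x Cx; apply: VO => i; exact: (Cx (absz i)).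
- by exists n.
Qed.

Lemma closure_homoclinic_subgroup V :
  subgroup V -> subgroup (closure (homoclinic T V)).
Proof. by move=> sV; exact/closure_subgroup/homoclinic_subgroup. Qed.

Lemma closure_homoclinic_ziter V i x :
  closure (homoclinic T V) x -> closure (homoclinic T V) (it i x).
Proof. by apply: closure_ziter => y; exact: homoclinic_ziter. Qed.

(* If [H0] is the group of homoclinic points whose past lies in [V], then
   [T(H0)/H0] is finite, with representatives returning to [V] after some time
   [M]. Hence [T^(M+n)(H0) <= V T^M(V)] for all [n] by induction. *)
Lemma homoclinic_bounded V : compact_open_subgroup V -> tidy T V ->
  exists2 Q, compact Q & homoclinic T V `<=` Q.
Proof.
move=> cosV tV; have [sV oV cV] := cosV.
have sH := homoclinic_subgroup T sV.
have [c cP] := coset_code scG sV oV.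
have lc := coset_code_locally_constant cP (compact_open_subgroup_nbhs cosV).
pose H0 := [set x | homoclinic T V x /\ forall n : nat, V (it (- n%:Z) x)].
have [B cB] := compact_locally_constant_bounded hG lc (compact_image (@aut_continuous _ T) cV).
have [M MP] : exists M : nat, forall x, H0 x -> exists a, [/\ homoclinic T V a,
    forall n : nat, V (it (- n.+1%:Z) a), c a = c (T x) &
    forall n : nat, (M <= n)%N -> V (it n a)].
  (* [T(V)] meets only finitely many cosets of [V], with codes below [B]. Induction on this bound
     treats one coset at a time and takes the maximum of the return times. *)
  suff [M MP] : exists M : nat, forall x, H0 x -> (c (T x) < B)%N ->
      exists a, [/\ homoclinic T V a,
        forall n : nat, V (it (- n.+1%:Z) a), c a = c (T x) &
        forall n : nat, (M <= n)%N -> V (it n a)].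
    exists M => x H0x; apply: MP => //; apply: cB; exists x => //.
    by case: H0x => _ /(_ 0%N).
  elim: {cB} B => [|b [M MP]]; first by exists 0%N.
  have [[x H0x cx]|nx] := pselect (exists2 x, H0 x & c (T x) = b); last first.
    exists M => x H0x; rewrite ltnS leq_eqVlt => /orP[/eqP cx|]; last exact: MP.
    by exfalso; apply: nx; exists x.
  have [Hx Vx] := H0x; have [N HN] := homoclinic_ziter 1%R Hx.
  exists (maxn M N) => y H0y; rewrite ltnS leq_eqVlt => /orP[/eqP cy|].
    exists (T x); split=> [|n||n].
    - by exists N.
    - by rewrite -ziter1 -ziterD (_ : _ + _ = - n%:Z)%R; [exact: Vx|lia].
    - by rewrite cx cy.
    - by rewrite geq_max => /andP[_ Nn]; exact: (HN n).
  move=> /(MP y H0y)[a [Ha Va ca Ma]]; exists a; split=> // n.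
  by rewrite geq_max => /andP[Mn _]; exact: Ma.
exists (mulset V (it M @` V)).
  apply: compact_mulset => //; apply: compact_image => //.
  exact: ziter_continuous.
have H0Q n x : H0 x -> mulset V (it M @` V) (it (M + n)%N x).
  elim: n x => [|n IH] x H0x; have [Hx Vx] := H0x.
    exists 1; first exact: subg1; exists (it M x); last by rewrite mul1g addn0.
    by exists x => //; exact: (Vx 0%N).
  have [a [Ha Va ca Ma]] := MP x H0x.
  (* Dividing [T x] by the representative [a] of its coset gives an element of [H0] again, and [a]
     itself is back in [V] at time [M + n]. *)
  have [|v Vv [w [u Vu uw] vw]] := IH (a^-1 * T x).
    split=> [|[|k]].
    - by apply: (subgM sH); [exact: (subgV sH)|exact: (homoclinic_ziter 1%R)].
    - exact/cP.
    - rewrite ziterM ziterV; apply: (subgM sV); first exact: (subgV sV).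
      by rewrite -(ziter1 T x) -ziterD (_ : _ + _ = - k%:Z)%R; [exact: Vx|lia].
  exists (it (M + n)%N a * v); first by apply: (subgM sV) Vv; apply: Ma; exact: leq_addr.
  exists w; first by exists u.
  rewrite -mulgA vw -ziterM mulVKg -(ziter1 T x) -ziterD; congr (it _ x); lia.
move=> x [n Hx]; have := H0Q n (it (- (M + n)%N%:Z) x); rewrite ziterKN; apply.
split=> [|k]; first by apply: homoclinic_ziter; exists n.
by rewrite -ziterD; apply: Hx; lia.
Qed.

Lemma closure_homoclinic_compact V : compact_open_subgroup V -> tidy T V ->
  compact (closure (homoclinic T V)).
Proof.
move=> cosV tV; have [Q cQ HQ] := homoclinic_bounded cosV tV.
apply: (subclosed_compact (@closed_closure _ _) cQ).
by move/closure_id: (compact_closed hG cQ) => ->; exact: closureS.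
Qed.

(* The forward orbit of [z] visits some coset [h V] infinitely often. As
   [T^(-j) z] tends to [core V], the point [z] can be modified by an element
   close to [core V] into one whose orbit starts in [h V] and comes back to
   [V]; splicing yields homoclinic points shadowing [z] up to arbitrarily large
   times. *)
Lemma past_in_bounded_future V z Q : compact_open_subgroup V -> tidy T V ->
  (forall n : nat, V (it (- n%:Z) z)) ->
  compact Q -> (forall n : nat, Q (it n z)) -> closure (homoclinic T V) z.
Proof.
move=> cosV tV Vz cQ Qz; have [sV oV cV] := cosV.
have sK := core_subgroup T sV; have sH := homoclinic_subgroup T sV.
have [c cP] := coset_code scG sV oV.
have lc := coset_code_locally_constant cP (compact_open_subgroup_nbhs cosV).
have shadow (m : nat) : exists2 r, homoclinic T V r &
    forall i : int, (i <= m)%R -> V ((it i z)^-1 * it i r).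
  have [B cB] := compact_locally_constant_bounded hG lc cQ.
  have [k kP] := @nat_pigeonhole (fun n => c (it n z)) B (fun n => cB _ (Qz n)).
  have [n1 mn1 cn1] := kP m.
  pose y := it n1 z.
  pose O := [set q | exists2 k, core T V k & V (y^-1 * (q * k^-1) * y)].
  have oO : open O.
    have -> : O = \bigcup_(k in core T V) [set q | V (y^-1 * (q * k^-1) * y)].
      by apply/seteqP; split=> q [k' Kk Vq]; exists k'.
    apply: bigcup_open => k' _.
    apply: (@open_preimage _ _ (fun q => y^-1 * (q * k'^-1) * y) V) => // q.
    apply: (@continuous_comp _ _ _ (fun q => y^-1 * (q * k'^-1)) (fun q => q * y)).
      apply: (@continuous_comp _ _ _ (fun q => q * k'^-1)); first exact: mulg_continuousr.
      exact: mulg_continuousl.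
    exact: mulg_continuousr.
  have [|n0 n0P] := window_absorb cosV oO.
    by move=> k' Kk; exists k' => //; rewrite mulgV mulg1; exact: coset_refl.
  (* The margin makes [n1 - N + i] nonpositive when [|i| <= n0], so that [T^(n1 - N) z] has its
     whole window in [V]. *)
  have [n2 n2P cn2] := kP (n1 + n1 + n0)%N.
  pose N := (n2 - n1)%N.
  have [|k' Kk Va] := n0P (it (n1%:Z - N%:Z) z).
    move=> i i_n; rewrite -ziterD (_ : _ + _ = - (absz (i + (n1%:Z - N%:Z)))%:Z)%R//.
    by lia.
  (* [w = k' q^-1 y] lies in [y V] by the choice of [O], and [T^N w = T^N(k') y^-1 T^n2(z)] lies in
     [V] because [z] visits the same coset at times [n1] and [n2]. *)
  set q := it _ z in Va; pose w := (q * k'^-1)^-1 * y.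
  have Vyw : V (y^-1 * w).
    have := subgV sV Va; rewrite /w !invgM !invgK !mulgA; exact.
  have VNw : V (it N w).
    rewrite /w ziterM ziterV ziterM ziterV.
    have -> : it N q = y by rewrite -ziterD /y; congr (it _ z); lia.
    rewrite invgM invgK -mulgA; apply: (subgM sV); first exact: Kk.
    rewrite -ziterD (_ : _ + _ = n2%:Z)%R; last lia.
    by apply/cP; rewrite /y cn1 cn2.
  (* Up to cosets of [V], [s] has the past of [y] and the future of [w], while [r] has the past of
     [T^N s] and the future of 1. Shifted by [N + n1], [r] follows [z] up to time [n1] and is in [V]
     from time [N + n1] on. *)
  have [s [sy sw]] := splice cosV tV Vyw.
  have VNs : V ((it N s)^-1 * 1).
    by rewrite mulg1; apply: (subgV sV); rewrite -(subgMl sV _ (subgV sV VNw)).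
  have [r [rs r1]] := splice cosV tV VNs.
  have rz i : (i <= n1%:Z)%R -> V ((it i z)^-1 * it (i - N%:Z - n1%:Z)%R r).
    move=> i_n; have := rs (absz (i - N%:Z - n1%:Z)%R).
    rewrite (_ : - _ = i - N%:Z - n1%:Z)%R; last lia.
    apply: coset_trans => //; rewrite -ziterD.
    have := sy (absz (i - n1%:Z)%R).
    rewrite (_ : - _ = i - n1%:Z)%R; last lia.
    rewrite -ziterD subrK (_ : _ + N%:Z = i - n1%:Z)%R//; lia.
  exists (it (- (N + n1)%N%:Z) r); last first.
    move=> i i_m; rewrite -ziterD (_ : _ + _ = i - N%:Z - n1%:Z)%R; last lia.
    by apply: rz; lia.
  exists (N + n1)%N => i; have [i0|i0] := lerP 0 i => iN.
    have := r1 (absz (i - N%:Z - n1%:Z)%R); rewrite ziterG1 invg1 mul1g -ziterD.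
    by rewrite (_ : (absz _)%:Z = i - (N + n1)%N%:Z)%R//; lia.
  rewrite -ziterD (_ : _ + _ = i - N%:Z - n1%:Z)%R; last lia.
  have Vi : V (it i z) by rewrite (_ : i = - (absz i)%:Z)%R; [exact: Vz|lia].
  have /rz/(subgM sV Vi) : (i <= n1%:Z)%R by lia.
  by rewrite mulVKg.
move=> U; rewrite nbhsE => -[U' [oU' U'z] U'U].
(* Shadowing puts [z^-1 r] only near some [k] in [core T V]; the point [r k^-1], still homoclinic,
   then falls into [U']. *)
pose O := [set q | exists2 k, core T V k & U' (z * (q * k^-1))].
have oO : open O.
  have -> : O = \bigcup_(k in core T V) [set q | U' (z * (q * k^-1))].
    by apply/seteqP; split=> q [k Kk Vq]; exists k.
  apply: bigcup_open => k _.
  apply: (@open_preimage _ _ (fun q => z * (q * k^-1)) U') => // q.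
  apply: (@continuous_comp _ _ _ (fun q => q * k^-1)); first exact: mulg_continuousr.
  exact: mulg_continuousl.
have [|n nO] := window_absorb cosV oO.
  by move=> k Kk; exists k => //; rewrite mulgV mulg1.
have [r Hr zr] := shadow n.
have [|k Kk Uk] := nO (z^-1 * r).
  by move=> i i_n; rewrite ziterM ziterV; apply: zr; lia.
exists (r * k^-1); split.
  by apply: (subgM sH) => //; apply: (subgV sH); exact: core_homoclinic.
by apply: U'U; move: Uk; rewrite mulgA mulVKg.
Qed.

Lemma eventually_bounded (f : nat -> G) N Q : compact Q ->
  (forall n, (N <= n)%N -> Q (f n)) ->
  exists2 Q', compact Q' & forall n, Q' (f n).
Proof.
elim: N Q => [|N IH] Q cQ Qf; first by exists Q => // n; exact: Qf.
apply: (IH (Q `|` [set f N])) => [|n].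
  by apply: compactU => //; exact: compact_set1.
by rewrite leq_eqVlt => /orP[/eqP <-|/Qf]; [right|left].
Qed.

Lemma past_in_closure_homoclinic V z Q (N0 N1 : nat) :
  compact_open_subgroup V -> tidy T V ->
  (forall n : nat, (N0 <= n)%N -> V (it (- n%:Z) z)) ->
  compact Q -> (forall n : nat, (N1 <= n)%N -> Q (it n z)) ->
  closure (homoclinic T V) z.
Proof.
move=> cosV tV Vz cQ Qz; pose z' := it (- N0%:Z) z.
have [|Q' cQ' Qz'] := @eventually_bounded (fun n => it n z') (N0 + N1)%N Q cQ.
  move=> n nN; rewrite -ziterD (_ : _ + _ = (n - N0)%N%:Z)%R; last lia.
  by apply: Qz; lia.
rewrite -(ziterKN T N0 z); apply: closure_homoclinic_ziter.
apply: (past_in_bounded_future cosV tV _ cQ') => // n.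
by rewrite -ziterD -opprD -PoszD; apply: Vz; exact: leq_addl.
Qed.

Lemma closure_coset_rep V S x : compact_open_subgroup V ->
  closure S x -> exists2 h, S h & V (x^-1 * h).
Proof.
move=> /compact_open_subgroup_nbhs/(nbhs_coset x) nV Sx.
by have [h [Sh Vh]] := Sx _ nV; exists h.
Qed.

(* Splicing with homoclinic points provides [l] in the compact closure of the
   homoclinic group with the same past as [x]; then [l^-1 x] has its past in
   [V]. *)
Lemma homoclinic_to_closure V x (N : nat) :
  compact_open_subgroup V -> tidy T V ->
  (forall i : int, (N <= absz i)%N -> exists2 l, closure (homoclinic T V) l &
     V (l^-1 * it i x)) ->
  closure (homoclinic T V) x.
Proof.
set L := closure _ => cosV tV xP; have [sV oV cV] := cosV.
have sL : subgroup L by exact: closure_homoclinic_subgroup.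
have cL : compact L by exact: closure_homoclinic_compact.
pose z := it (- N%:Z) x.
have past_z (n : nat) : exists2 h, homoclinic T V h & V (h^-1 * it (- n%:Z) z).
  have [|l Ll Vl] := xP (- (n + N)%N%:Z); first by lia.
  have [h Hh Vh] := closure_coset_rep cosV Ll.
  exists h => //; rewrite -ziterD -opprD -PoszD.
  exact: coset_trans (coset_sym sV Vh) Vl.
pose C (n : nat) := L `&`
  [set l | forall i : int, (i <= 0)%R /\ (absz i <= n)%N -> V ((it i z)^-1 * it i l)].
have clC n : closed (C n).
  apply: closedI; first exact: closed_closure.
  exact: (@ziter_preimage_closed _ T V
    [set i : int | (i <= 0)%R /\ (absz i <= n)%N] _ (compact_open_subgroup_closed cosV)).
have [||||l Cl] := @compact_nested_nonempty _ C.
- by apply: (subclosed_compact (clC 0%N) cL) => l [].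
- by [].
- by move=> n l [Ll Cl]; split=> // i [i0 i_n]; apply: Cl; split=> //; exact: leqW.
(* Two splices: a homoclinic point in the coset of [T^-n z] supplies the times before [-n], [z]
   those from [-n] to 0, and a homoclinic point in the coset of [z] the later ones. *)
- move=> n; have [a [na Ha] Va] := past_z n; have [b [nb Hb] Vb] := past_z 0%N.
  have [s [sa sz]] := splice cosV tV Va.
  have Vsb : V ((it n s)^-1 * b).
    have := sz n; rewrite ziterKN => Vzs.
    by apply: (coset_trans sV (coset_sym sV Vzs)); exact: coset_sym Vb.
  have [t [ts tb]] := splice cosV tV Vsb.
  have ts' (k : nat) : V ((it (n%:Z - k%:Z) s)^-1 * it (- k%:Z) t).
    by have := ts k; rewrite -ziterD addrC.
  exists t; split; last first.
    move=> i [i0 i_n]; have := ts' (absz i).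
    rewrite (_ : - (absz i)%:Z = i)%R; last lia.
    apply: coset_trans => //.
    have := sz (absz (n%:Z + i)%R).
    rewrite (_ : (absz (n%:Z + i)%R)%:Z = n%:Z + i)%R; last lia.
    by rewrite -ziterD (_ : n%:Z + i - n%:Z = i)%R//; lia.
  apply: subset_closure; exists (n + na + nb)%N => i; have [i0|i0] := lerP 0 i => iN.
    have := tb (absz i); rewrite gez0_abs//; apply: coset_mem => //.
    by apply: Hb; lia.
  have := ts' (absz i); rewrite (_ : - (absz i)%:Z = i)%R; last lia.
  apply: coset_mem => //; have := sa (absz (n%:Z + i)%R).
  rewrite (_ : - (absz _)%:Z = n%:Z + i)%R; last lia.
  by apply: coset_mem => //; apply: Ha; lia.
have Ll : L l by case: (Cl 0%N).
have Lit i y : L y -> L (it i y) by exact: closure_homoclinic_ziter.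
suff : L (l^-1 * z).
  move=> /(subgM sL Ll); rewrite mulVKg => /(Lit N).
  by rewrite ziterKN.
(* As [z = T^-N x], the hypothesis on [x] controls [T^n z] once [n - N >= N], whence the constant
   [N + N]. *)
apply: (@past_in_closure_homoclinic V _ (mulset L V) 0%N (N + N)%N) => //.
- move=> n _; rewrite ziterM ziterV; apply: coset_sym => //.
  by have [_] := Cl n; apply; lia.
- exact: compact_mulset.
- move=> n nN; have [|m Lm Vm] := xP (n%:Z - N%:Z)%R; first by lia.
  exists ((it n l)^-1 * m).
    by apply: (subgM sL) => //; apply: (subgV sL); exact: Lit.
  exists (m^-1 * it (n%:Z - N%:Z) x) => //.
  by rewrite mulgA mulgK ziterM ziterV -ziterD.
Qed.

End HomoclinicClosure.

(** * Splitting off full shifts *)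

Section FullShiftFactor.
Variables (G : topologicalGroupType) (T : automorphism G).
Implicit Types (x y : G) (U V W L M : set G).
Local Notation it := (ziter T).

Hypothesis hG : hausdorff_space G.
Hypothesis scG : @second_countable G.

(** The intersection of the conjugates of a tidy [V0] by the compact group [L0] is still open.
    Making it tidy again preserves the normalization, because [L0] is [T]-invariant and contains the
    new homoclinic closure. *)
Lemma exists_normalized_tidy U : compact_open_subgroup U ->
  exists V, [/\ compact_open_subgroup V, V `<=` U, tidy T V &
    forall l v, closure (homoclinic T V) l -> V v -> V (l^-1 * v * l)].
Proof.
move=> cosU; have [n0] := exists_tidy T cosU.
set V0 := past_core T U n0 => tV0.
have cosV0 : compact_open_subgroup V0 by exact: past_core_compact_open_subgroup.
have V0U : V0 `<=` U by move=> x /(_ 0%N (leq0n _)).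
clearbody V0; have [sV0 oV0 cV0] := cosV0.
set L0 := closure (homoclinic T V0).
have sL0 : subgroup L0 by exact: closure_homoclinic_subgroup.
have cL0 : compact L0 by exact: closure_homoclinic_compact.
pose V' := [set x | forall l, L0 l -> V0 (l^-1 * x * l)].
have V'V0 : V' `<=` V0.
  by move=> x /(_ 1 (subg1 sL0)); rewrite invg1 mul1g mulg1.
have sV' : subgroup V'.
  split=> [l _|x y Vx Vy l Ll|x Vx l Ll].
  - by rewrite mulg1; exact: coset_refl.
  - have := subgM sV0 (Vx l Ll) (Vy l Ll).
    by rewrite !mulgA mulgK.
  - by have := subgV sV0 (Vx l Ll); rewrite !invgM invgK mulgA.
have nV' : nbhs 1 V'.
  have /compact_near_coveringP := cL0.
  move=> /(_ _ (nbhs (1 : G)) (fun x l => V0 (l^-1 * x * l))); apply=> l Ll.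
  have cconj : continuous (fun p : G * G => p.1^-1 * p.2 * p.1).
    move=> p; apply: (@continuous_comp _ _ _ (fun p : G * G => (p.1^-1 * p.2, p.1))
                        (fun q => q.1 * q.2)); last exact: mulg_continuous.
    apply: cvg_pair; last exact: cvg_fst.
    apply: (@continuous_comp _ _ _ (fun p : G * G => (p.1^-1, p.2))
                        (fun q => q.1 * q.2)); last exact: mulg_continuous.
    apply: cvg_pair; last exact: cvg_snd.
    apply: (@continuous_comp _ _ _ (fun p : G * G => p.1)); first exact: cvg_fst.
    exact: invg_continuous.
  apply: (cconj (l, 1)); rewrite /= mulg1 mulVg; exact: compact_open_subgroup_nbhs.
have oV' : open V' by exact: nbhs1_open_subgroup.
have cosV' : compact_open_subgroup V'.
  by split=> //; apply: subclosed_compact cV0 _ => //; exact: open_subgroup_closed.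
have [n tV] := exists_tidy T cosV'; exists (past_core T V' n); split=> //.
- exact: past_core_compact_open_subgroup.
- by move=> x /(_ 0%N (leq0n _))/V'V0/V0U.
- move=> l v Hl Vv k kn l' Ll'; rewrite !ziterM ziterV.
  have Ll : L0 (it (- k%:Z) l).
    apply: closure_homoclinic_ziter; move: Hl; apply: closureS; apply: homoclinicS.
    by move=> x /(_ 0%N (leq0n _))/V'V0.
  have := Vv k kn _ (subgM sL0 Ll Ll').
  by rewrite invgM !mulgA.
Qed.

(** [L] stays fixed while [V] is enlarged. The last clause says that a point with both tails in
    [L V] lies in [L]; for a closed subgroup [L] the last two clauses give
    [L = closure (homoclinic T V)]. *)
Definition adapted L V :=
  [/\ compact_open_subgroup V, tidy T V,
      forall l v, L l -> V v -> V (l^-1 * v * l),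
      L `<=` closure (homoclinic T V) &
      forall x (N : nat), (forall i : int, (N <= absz i)%N ->
        exists2 l, L l & V (l^-1 * it i x)) -> L x].

Lemma adapted_closure_homoclinic V : compact_open_subgroup V -> tidy T V ->
  (forall l v, closure (homoclinic T V) l -> V v -> V (l^-1 * v * l)) ->
  adapted (closure (homoclinic T V)) V.
Proof.
by move=> cosV tV nV; split=> // x N; exact: homoclinic_to_closure.
Qed.

(* In the group shift [L / core V], whose alphabet is [L / (L ∩ V)], this adds
   to [V] the predecessors of the identity. *)
Definition enlarge L V : set G :=
  [set x | exists q, [/\ L q, V (T q) & V (q^-1 * x)]].

Definition rep_invariant (A : Type) (f : G -> A) V :=
  forall x y, V (x^-1 * y) -> f x = f y.

(** [M / V] is finite, and [x] is labelled by the class of [(r x)^-1 * x], where [r x] is a chosen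
    representative of the coset [x M]. Since [K] meets every coset of [V] in [M], right
    multiplication by [K] reaches every label. *)
Lemma finite_coset_labelling V M (K : set G) :
  subgroup V -> open V -> subgroup M -> compact M -> V `<=` M -> K `<=` M ->
  (forall m, M m -> exists2 k, K k & V (k^-1 * m)) ->
  exists (D : finType) (f : G -> D),
    [/\ rep_invariant f V,
        forall x y, M (x^-1 * y) -> f x = f y -> V (x^-1 * y) &
        forall g d, exists2 k, K k & f (g * k) = d].
Proof.
move=> sV oV sM cM VM KM MK.
have oM : open M.
  apply: nbhs1_open_subgroup => //.
  by apply: filterS VM _; apply: open_nbhs_nbhs; split=> //; exact: subg1.
have nV : nbhs 1 V by apply: open_nbhs_nbhs; split=> //; exact: subg1.
have [c cP] := coset_code scG sV oV; have [e eP] := coset_code scG sM oM.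
have [n cn] := compact_locally_constant_bounded hG
  (coset_code_locally_constant cP nV) cM.
pose s := [seq k <- iota 0 n | `[< exists2 m, M m & c m = k >]].
have sP k : k \in s <-> exists2 m, M m & c m = k.
  rewrite mem_filter; split=> [/andP[/asboolP//]|[m Mm <-]].
  by apply/andP; split; [apply/asboolP; exists m|rewrite mem_iota cn].
have [rho rhoP] : exists rho : nat -> G, forall x, e (rho (e x)) = e x.
  have /choice[rho rhoP] : forall k, exists g : G, (exists x, e x = k) -> e g = k.
    move=> k; have [[x ex]|nx] := pselect (exists x, e x = k); first by exists x.
    by exists 1.
  by exists rho => x; apply: rhoP; exists x.
pose r x := rho (e x).
have rM x : M ((r x)^-1 * x) by apply: (eP (r x) x).1; exact: rhoP.
have rE x y : M (x^-1 * y) -> r x = r y by move=> /eP; rewrite /r => ->.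
have s1 : c 1 \in s by apply/sP; exists 1 => //; exact: subg1.
pose f x : seq_sub s := insubd (SeqSub s1) (c ((r x)^-1 * x)).
have fE x : val (f x) = c ((r x)^-1 * x).
  rewrite /f val_insubd; case: ifP => // /negbT/negP []; apply/sP.
  by exists ((r x)^-1 * x).
have fP x y : M (x^-1 * y) -> f x = f y <-> V (x^-1 * y).
  move=> Mxy; have -> : f x = f y <-> c ((r x)^-1 * x) = c ((r x)^-1 * y).
    rewrite {2}(rE _ _ Mxy) -!fE; split=> [->//|]; exact: val_inj.
  rewrite cP invgM invgK -mulgA mulVKg.
  by split.
exists (seq_sub s), f; split.
- by move=> x y Vxy; apply/fP => //; exact: VM.
- by move=> x y Mxy /fP; apply.
- move=> g d; have /sP[m Mm cm] := ssvalP d.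
  pose m' := (r g)^-1 * g.
  have [k Kk Vk] := MK (m'^-1 * m) (subgM sM (subgV sM (rM g)) Mm).
  exists k => //; apply: val_inj; rewrite fE -[RHS]cm.
  have -> : r (g * k) = r g.
    by apply: rE; rewrite invgM -mulgA mulVg mulg1; exact: (subgV sM (KM _ Kk)).
  apply/cP; move: Vk; rewrite /m' !invgM !invgK.
  by rewrite !mulgA.
Qed.

Variable L : set G.
Hypotheses (sL : subgroup L) (cL : compact L).
Hypothesis Lit : forall i x, L x -> L (it i x).

Section Enlarge.
Variable V : set G.
Hypothesis aV : adapted L V.

Let sV : subgroup V. Proof. by case: aV => -[]. Qed.
Let oV : open V. Proof. by case: aV => -[]. Qed.
Let cV : compact V. Proof. by case: aV => -[]. Qed.
Let nV l v : L l -> V v -> V (l^-1 * v * l).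
Proof. by case: aV => _ _ + _ _; apply. Qed.
Let nV' l v : L l -> V v -> V (l * v * l^-1).
Proof. by move=> /(subgV sL)/nV/[apply]; rewrite invgK. Qed.

Lemma sub_enlarge : V `<=` enlarge L V.
Proof.
move=> x Vx; exists 1; split; rewrite ?invg1 ?mul1g//; first exact: subg1.
by rewrite -ziter1 ziterG1; exact: subg1.
Qed.

Lemma enlarge_adapted : adapted L (enlarge L V).
Proof.
have [cosV tV _ LV tailV] := aV.
have sE : subgroup (enlarge L V).
  split=> [|x y [p [Lp Vp Vx]] [q [Lq Vq Vy]]|x [q [Lq Vq Vx]]].
  - by apply: sub_enlarge; exact: subg1.
  - exists (p * q); split; first exact: subgM.
      by rewrite autM; exact: subgM.
    have := subgM sV (nV Lq Vx) Vy.
    by rewrite invgM !mulgA mulgK.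
  - exists q^-1; split; first exact: subgV.
      by rewrite aut_invg; exact: subgV.
    by have := nV' Lq (subgV sV Vx); rewrite invgM !invgK !mulgA mulgK.
have oE : open (enlarge L V).
  apply: nbhs1_open_subgroup => //; apply: filterS sub_enlarge _.
  exact: compact_open_subgroup_nbhs.
split=> //.
- split=> //; apply: subclosed_compact (compact_mulset cL cV) _.
    exact: open_subgroup_closed.
  by move=> x [q [Lq _ Vx]]; exists q => //; exists (q^-1 * x) => //; rewrite mulVKg.
- move=> x [q [Lq Vq Vx]].
  (* With [v = q^-1 x] one has [x = (q v q^-1) q]. Split [q v q^-1 = a b] and let [b] absorb [q],
     which is possible since [T q] is in [V]. *)
  have [a [b [E Va Vb VTb]]] := tV _ (nV' Lq Vx).
  have Eq : enlarge L V q by exists q; split=> //; exact: coset_refl.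
  exists a, (b * q); split.
  + by rewrite mulgA -E mulVKg mulgVK.
  + by move=> n; exact/sub_enlarge/Va.
  + by apply: (subgM sE) => //; exact: sub_enlarge.
  + by rewrite autM; apply: sub_enlarge; exact: subgM.
- move=> l x Ll [q [Lq Vq Vx]]; exists (l^-1 * q * l); split.
  + by apply: subgM => //; apply: subgM => //; exact: subgV.
  + by rewrite !autM aut_invg; apply: nV => //; exact: (Lit 1%R).
  + by have := nV Ll Vx; rewrite !invgM !invgK !mulgA mulgK.
- by move=> x /LV; apply: closureS; apply: homoclinicS; exact: sub_enlarge.
- move=> x N xP; apply: (tailV x N) => i iN.
  have [l Ll [q [Lq _ Vq]]] := xP i iN; exists (l * q); first exact: subgM.
  by rewrite invgM -mulgA.
Qed.

Lemma core_enlarge_sub x : core T (enlarge L V) x -> L x.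
Proof.
case: aV => _ _ _ _ tailV Ex; apply: (tailV x 0%N) => i _.
by have [q [Lq _ Vq]] := Ex i; exists q.
Qed.

(* The kernel of the factor map [L / core V -> L / core (enlarge L V)] is a
   full shift: an element of [enlarge L V] is followed by every element of
   [T(enlarge L V)]. *)
Lemma core_enlarge_free (k : int -> G) :
  (forall i, core T (enlarge L V) (k i)) ->
  exists2 x, core T (enlarge L V) x & forall i, V ((k i)^-1 * it i x).
Proof.
move=> Kk; have [cosV tV _ _ _] := aV.
have [[sE _ _] _ _ _ _] := enlarge_adapted.
have [i|x xP] := realize_path cosV tV (g := k).
  have [q [Lq Vq Vk]] := Kk i 0.
  have [q' [Lq' Vq' Vk']] := Kk (i + 1%R) (- 1%R).
  have Lk := core_enlarge_sub (Kk (i + 1%R)).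
  (* This element lies in [k_i V] by the choice of [q] and [q']; its image lies in [V k_(i+1)],
     which is [k_(i+1) V] by normalization. *)
  exists (q * (q'^-1 * it (- 1%R) (k (i + 1%R)))).
    have := subgM sV (subgV sV Vk) Vk'.
    by rewrite invgM invgK !mulgA.
  rewrite autM autM aut_invg -[X in _ * (_ * X)]ziter1 ziterKN mulgA.
  have := nV Lk (subgM sV Vq (subgV sV Vq')).
  by rewrite !mulgA.
by exists x => // i; exact: (coset_mem sE (Kk i 0) (sub_enlarge (xP i))).
Qed.

(** [finite_coset_labelling] applies to [M = K V]: this is a group because [K], inside [L],
    normalizes [V], and it is compact as an open subgroup inside [enlarge L V]. *)
Lemma enlarge_labelling : exists (D : finType) (f : G -> D),
  [/\ rep_invariant f V,
      forall x y, core T (enlarge L V) (x^-1 * y) -> f x = f y -> V (x^-1 * y) &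
      forall g d, exists2 k, core T (enlarge L V) k & f (g * k) = d].
Proof.
set K := core T _; have KL : K `<=` L by exact: core_enlarge_sub.
have [[sE oE cE] _ _ _ _] := enlarge_adapted.
have sK : subgroup K by exact: core_subgroup.
pose M := [set x | exists2 k, K k & V (k^-1 * x)].
have VM : V `<=` M.
  by move=> v Vv; exists 1; [exact: (subg1 sK)|rewrite invg1 mul1g].
have KM : K `<=` M by move=> k Kk; exists k => //; exact: coset_refl.
have sM : subgroup M.
  split=> [|x y [p Kp Vx] [q Kq Vy]|x [q Kq Vx]].
  - by apply: VM; exact: subg1.
  - exists (p * q); first exact: (subgM sK).
    by have := subgM sV (nV (KL _ Kq) Vx) Vy; rewrite invgM !mulgA mulgK.
  - exists q^-1; first exact: (subgV sK).
    by have := nV' (KL _ Kq) (subgV sV Vx); rewrite invgM !invgK !mulgA mulgK.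
have [||D [f [fV fM fK]]] := finite_coset_labelling sV oV sM _ VM KM.
- apply: subclosed_compact cE _; last first.
    by move=> x [k Kk Vk]; exact: (coset_mem sE (Kk 0) (sub_enlarge Vk)).
  apply: open_subgroup_closed => //; apply: nbhs1_open_subgroup => //.
  by apply: filterS VM _; apply: compact_open_subgroup_nbhs; case: aV.
- by move=> m [k Kk Vk]; exists k.
- by exists D, f; split=> // x y /KM; exact: fM.
Qed.

End Enlarge.

Lemma iter_enlarge_adapted V n : adapted L V -> adapted L (iter n (enlarge L) V).
Proof. by move=> aV; elim: n => // n IH; exact: enlarge_adapted. Qed.

(** Once the chain is stationary, [L ∩ T^-1 E_n] lies in [E_n]. A homoclinic point of [E_n] is in
    [E_n] at late times, hence, going backwards, at all times. So the closed set [core T E_n]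
    contains the closure of the homoclinic group, which contains [L]. *)
Lemma iter_enlarge_stable V : adapted L V -> exists n,
  L `<=` core T (iter n (enlarge L) V).
Proof.
move=> aV; pose E n := iter n (enlarge L) V.
have aE n : adapted L (E n) by exact: iter_enlarge_adapted.
have sE n : subgroup (E n) by have [[]] := aE n.
have oE n : open (E n) by have [[]] := aE n.
have ES n : E n `<=` E n.+1 by apply: sub_enlarge; exact: aE.
have Ele m n : (m <= n)%N -> E m `<=` E n.
  move=> /subnK <-; elim: (n - m)%N => // k IH x /IH.
  by rewrite addSn; exact: ES.
pose U := \bigcup_n E n.
have sU : subgroup U.
  split=> [|x y [m _ Ex] [n _ Ey]|x [n _ Ex]].
  - by exists 0%N => //; exact: subg1.
  - exists (maxn m n) => //; apply: subgM => //; first exact: Ele (leq_maxl _ _) _ Ex.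
    exact: Ele (leq_maxr _ _) _ Ey.
  - by exists n => //; exact: subgV.
have oU : open U by apply: bigcup_open => n _.
have [cosV _ _ _ _] := aV; have [sV _ cV] := cosV.
have cU : compact U.
  apply: subclosed_compact (compact_mulset cL cV) _.
    exact: open_subgroup_closed.
  have EL n x : E n x -> exists2 l, L l & V (l^-1 * x).
    elim: n x => [|n IH] x; first by move=> Vx; exists 1; [exact: subg1|rewrite invg1 mul1g].
    move=> [q [Lq _ /IH[l Ll Vl]]]; exists (q * l); first exact: subgM.
    by rewrite invgM -mulgA.
  move=> x [n _ /EL[l Ll Vl]]; exists l => //; exists (l^-1 * x) => //.
  by rewrite mulVKg.
have [|||||n nC] := @compact_nested _ (fun n => U `&` ~` E n) set0.
- apply: subclosed_compact cU _ => [|x []//].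
  by apply: closedI; [exact: open_subgroup_closed|exact: open_closedC].
- by move=> n; apply: closedI; [exact: open_subgroup_closed|exact: open_closedC].
- by move=> n x [Ux nEx]; split=> // /ES.
- exact: open0.
- by move=> x Cx; have [[n _ Ex] _] := Cx 0%N; case: (Cx n).
exists n; have stable x : L x -> E n (T x) -> E n x.
  move=> Lx Ex; apply: contrapT => nEx; apply: (nC x); split=> //.
  by exists n.+1 => //; exists x; split=> //; exact: coset_refl.
have [cosE _ _ LE tailE] := aE n; have clE := compact_open_subgroup_closed cosE.
have HK : homoclinic T (E n) `<=` core T (E n).
  move=> h [N hN].
  have Lh : L h.
    apply: (tailE h N) => i iN; exists 1; first exact: subg1.
    by rewrite invg1 mul1g; exact: hN.
  have down (k : nat) i : (N%:Z - k%:Z <= i)%R -> E n (it i h).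
    elim: k i => [|k IH] i ik; first by apply: hN; lia.
    apply: stable; first exact: Lit.
    by rewrite -ziterS; apply: IH; lia.
  by move=> i; apply: (down (N + absz i)%N); lia.
move=> l /LE; have /closure_id -> := core_closed (T := T) clE.
exact: closureS.
Qed.

(* [x ↦ (x L, (f (T^i x))_i)] identifies [G / core V] with the product of
   [G / L] and the full shift on [D]. *)
Definition splitting V W (D : finType) (f : G -> D) :=
  [/\ adapted L W, L `<=` core T W, locally_constant f,
      forall x y, L (x^-1 * y) ->
        ((forall i, f (it i x) = f (it i y)) <-> core T V (x^-1 * y)) &
      forall g (d : int -> D),
        exists2 x, L (g^-1 * x) & forall i, f (it i x) = d i].

(** Each enlargement contributes one letter, collected in a product alphabet; the induction starts
    with a one-letter alphabet when [L] already lies in [core T V]. *)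
Lemma exists_splitting V : adapted L V ->
  exists W (D : finType) (f : G -> D), splitting V W f.
Proof.
move=> aV; have [n] := iter_enlarge_stable aV.
elim: n V aV => [|n IH] V aV; last first.
  rewrite iterSr => /(IH _ (enlarge_adapted aV))[W [D [f [aW LW lf fib onto]]]].
  have [D' [f' [fV fE fK]]] := enlarge_labelling aV.
  have [[sV oV _] _ _ _ _] := aV.
  have [[sE _ _] _ _ _ _] := enlarge_adapted aV.
  exists W, (D * D')%type, (fun x => (f x, f' x)); split=> //.
  - move=> x; have nV : nbhs 1 V by apply: compact_open_subgroup_nbhs; case: aV.
    by apply: filterS2 (lf x) (nbhs_coset x nV) => y -> /fV ->.
  - move=> x y Lxy; split=> [ff i|Vxy i].
      have Kxy : core T (enlarge L V) (x^-1 * y).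
        by apply/fib => // j; case: (ff j).
      rewrite ziterM ziterV; apply: fE; last by case: (ff i).
      by rewrite -ziterV -ziterM; exact: core_ziter.
    have Kxy : core T (enlarge L V) (x^-1 * y).
      by move=> j; exact/(sub_enlarge aV)/Vxy.
    congr pair; first exact: (fib x y Lxy).2.
    by apply: fV; rewrite -ziterV -ziterM; exact: Vxy.
  (* First [x] realizes the first components within the coset of [L]. Multiplying it by [z] in the
     core of [enlarge L V] leaves them unchanged and prescribes the second components independently
     at each time. *)
  - move=> g d; have [x Lx fx] := onto g (fun i => (d i).1).
    have /choice[k kP] : forall i, exists k, core T (enlarge L V) k /\
        f' (it i x * k) = (d i).2.
      by move=> i; have [k Kk fk] := fK (it i x) (d i).2; exists k.
    have [i|z Kz zP] := core_enlarge_free aV (k := k); first by case: (kP i).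
    have Lz := core_enlarge_sub aV Kz.
    exists (x * z); first by rewrite mulgA; exact: subgM.
    move=> i; rewrite [d i]surjective_pairing -fx -(kP i).2; congr pair.
      apply/esym; apply: (fib _ _ _).2; rewrite mulKg//.
    apply/esym; apply: fV; rewrite ziterM invgM -mulgA mulKg; exact: zP.
rewrite /= => LV; exists V, unit, (fun=> tt); split=> //.
- by move=> x; exact: filterE.
- by move=> x y /LV.
- move=> g d; exists g; first exact: coset_refl.
  by move=> i; case: (d i).
Qed.

End FullShiftFactor.

(** * Bounded orbits *)

Lemma finite_zorbit (X : Type) (S : X -> X) x m : injective S -> (0 < m)%N ->
  iter m S x = x -> finite_set (zorbit S x).
Proof.
move=> Sinj m0 Sm.
have Smk k : iter (k * m) S x = x.
  by elim: k => [//|k IH]; rewrite mulSn iterD IH.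
have iterP n : [set iter k S x | k in `I_m] (iter n S x).
  by exists (n %% m)%N; [exact: ltn_pmod|rewrite [in RHS](divn_eq n m) addnC iterD Smk].
apply: (@sub_finite_set _ _ [set iter k S x | k in `I_m]); last first.
  exact/finite_image/finite_II.
move=> y [n [->|Sny]]; first exact: iterP.
have iter_inj : injective (iter n S) by elim: n {Sny} => [|n IH] a b //= /Sinj/IH.
have -> : y = iter (n * m - n) S x; last exact: iterP.
by apply: iter_inj; rewrite Sny -iterD subnKC ?Smk// leq_pmulr.
Qed.

Section BoundedOrbits.
Variables (G : topologicalGroupType) (T : automorphism G).
Implicit Types (x y : G) (V W Q : set G).
Local Notation it := (ziter T).

Hypothesis hG : hausdorff_space G.
Hypothesis scG : @second_countable G.

Definition bounded_orbit x := exists2 Q, compact Q & forall i, Q (it i x).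

Lemma compact_orbit_closureP x : compact_orbit_closure T x <-> bounded_orbit x.
Proof.
split=> [cx|[Q cQ Qx]].
  exists (closure (zorbit T x)) => // i; apply: subset_closure.
  by apply/zorbitP; exists i.
apply: (subclosed_compact (@closed_closure _ _) cQ).
move/closure_id: (compact_closed hG cQ) => ->; apply: closureS.
by move=> _ /zorbitP[i ->].
Qed.

Variables L W : set G.
Hypotheses (sL : subgroup L) (cL : compact L).
Hypothesis aW : adapted T L W.
Hypothesis LW : L `<=` core T W.

Let cosW : compact_open_subgroup W. Proof. by case: aW. Qed.
Let sW : subgroup W. Proof. by case: cosW. Qed.
Let oW : open W. Proof. by case: cosW. Qed.
Let cW : compact W. Proof. by case: cosW. Qed.
Let tW : tidy T W. Proof. by case: aW. Qed.

Lemma adapted_core V : adapted T L V -> core T V `<=` L.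
Proof.
case=> _ _ _ _ tailV x Vx; apply: (tailV x 0%N) => i _.
by exists 1; [exact: subg1|rewrite invg1 mul1g].
Qed.

(** [past_in_bounded_future] places [z] in the closure of the homoclinic group of [W], and the last
    clause of [adapted] puts that group inside the closed set [L]. *)
Lemma past_in_bounded_mem z Q : (forall n : nat, W (it (- n%:Z) z)) ->
  compact Q -> (forall n : nat, Q (it n z)) -> L z.
Proof.
move=> Wz cQ Qz; have := past_in_bounded_future hG scG cosW tW Wz cQ Qz.
have clL : closed L by exact: compact_closed.
move/closure_id: clL => ->; apply: closureS => x [N Nx].
have [_ _ _ _ tailW] := aW; apply: (tailW x N) => i /Nx Wi.
by exists 1; [exact: subg1|rewrite invg1 mul1g].
Qed.

(** Splice the past of [x] and the future of [y] into [s]. Then [s^-1 x] has its past in [W] and a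
    bounded future, so it lies in [L], hence in [core T W]. Thus [x] shares its future cosets with
    [s], and so with [y]. *)
Lemma spliced_mem x y : bounded_orbit x -> bounded_orbit y -> W (x^-1 * y) ->
  forall n : nat, W ((it n x)^-1 * it n y).
Proof.
move=> [Q cQ Qx] [Q' cQ' Qy] Wxy n.
have [s [sx sy]] := splice cosW tW Wxy.
have Ls : L (s^-1 * x).
  apply: (@past_in_bounded_mem _ (mulset ((fun x => x^-1) @` (mulset Q' W)) Q)).
  - by move=> k; rewrite ziterM ziterV; exact: coset_sym (sx k).
  - apply: compact_mulset => //; apply: compact_image.
      exact: invg_continuous.
    exact: compact_mulset.
  - move=> k; rewrite ziterM ziterV; exists (it k s)^-1; last by exists (it k x).
    exists (it k s) => //; exists (it k y) => //.
    by exists ((it k y)^-1 * it k s) => //; rewrite mulVKg.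
have := LW Ls n; rewrite ziterM ziterV => Wsx.
exact: (coset_sym sW (coset_trans sW (sy n) Wsx)).
Qed.

Lemma bounded_orbit_ziter i x : bounded_orbit x -> bounded_orbit (it i x).
Proof. by case=> Q cQ Qx; exists Q => // j; rewrite -ziterD. Qed.

(* [spliced_mem] makes the itinerary of [x] periodic from time [- b] on, for
   infinitely many [b]. *)
Lemma bounded_orbit_periodic x : bounded_orbit x ->
  exists2 m : nat, (0 < m)%N & L (x^-1 * it m x).
Proof.
move=> bx; have [Q cQ Qx] := bx.
have [c cP] := coset_code scG sW oW.
have lc := coset_code_locally_constant cP (compact_open_subgroup_nbhs cosW).
have [B cB] := compact_locally_constant_bounded hG lc cQ.
have [k kP] := @nat_pigeonhole (fun n => c (it (- n%:Z) x)) B (fun n => cB _ (Qx _)).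
have period (a b : nat) t : c (it (- a%:Z) x) = k -> c (it (- b%:Z) x) = k ->
    (- b%:Z <= t)%R -> c (it (t + (b%:Z - a%:Z)) x) = c (it t x).
  move=> ca cb bt; apply/cP.
  have := spliced_mem (bounded_orbit_ziter (- a%:Z) bx)
    (bounded_orbit_ziter (- b%:Z) bx) _ (absz (t + b%:Z)%R).
  rewrite -!ziterD.
  rewrite (_ : _ - a%:Z = t + (b%:Z - a%:Z))%R; last lia.
  rewrite (_ : _ - b%:Z = t)%R; last lia.
  by apply; apply/cP; rewrite ca cb.
have [n1 _ c1] := kP 0%N; have [n2 n12 c2] := kP n1.+1.
exists (n2 - n1)%N; first lia.
apply: (adapted_core aW) => t; rewrite ziterM ziterV -ziterD; apply/cP/esym.
(* From time [-b] on the itinerary has period [p = b - n2]. Moving [t] by [p q] brings it past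
   [-n2], where the period [n2 - n1] is available. *)
have [b bP cb] := kP (n2.+1 + absz t)%N; pose p := (b - n2)%N.
have periodp q u : (- b%:Z <= u)%R -> c (it (u + (p * q)%N%:Z) x) = c (it u x).
  elim: q => [|q IH] bu; first by rewrite muln0 addr0.
  rewrite -(IH bu) -(@period n2 b (u + (p * q)%N%:Z))//; last lia.
  congr (c (it _ x)); rewrite mulnS; lia.
pose q := (n2 + absz t)%N.
have pq : (q <= p * q)%N by rewrite leq_pmull// /p; lia.
rewrite -(periodp q t); last lia.
rewrite -(periodp q (t + _)%R); last lia.
rewrite -(@period n1 n2 (t + (p * q)%N%:Z))//; last lia.
congr (c (it _ x)); lia.
Qed.

(** By density, any [w] and [T w] share their cosets of [W] with [y] and [T y] for some bounded [y];
    so [W] is [T]-invariant and equal to its core. *)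
Lemma dense_bounded_open : dense bounded_orbit -> W `<=` L.
Proof.
move=> db; have fwd y (n : nat) : bounded_orbit y -> W y -> W (it n y).
  move=> by_ Wy; have b1 : bounded_orbit 1.
    by exists [set 1]; [exact: compact_set1|move=> i; rewrite ziterG1].
  have := spliced_mem b1 by_ _ n; rewrite ziterG1 invg1 !mul1g; exact.
have o2 (a b : G) : open [set y | W (a^-1 * y) /\ W (b^-1 * T y)].
  apply: openI; first exact: open_preimage (@mulg_continuousl _ a^-1) oW.
  apply: (@open_preimage _ _ (fun y => b^-1 * T y) W) => // y.
  apply: (@continuous_comp _ _ _ T); first exact: aut_continuous.
  exact: mulg_continuousl.
have WT w : W w -> W (T w).
  move=> Ww; have [|y [[Wy WTy] by_]] := db _ _ (o2 1 (T w)).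
    by exists w; split; [rewrite invg1 mul1g|exact: coset_refl].
  have /(fwd y 1%N by_) WTy' : W y by rewrite invg1 mul1g in Wy.
  exact: (coset_mem sW WTy' (coset_sym sW WTy)).
have TW w : W (T w) -> W w.
  move=> WTw; have [|y [[Wy WTy] by_]] := db _ _ (o2 w 1).
    by exists w; split; [exact: coset_refl|rewrite invg1 mul1g].
  rewrite invg1 mul1g in WTy.
  have [[//|m] _ Lm] := bounded_orbit_periodic by_.
  have Wm : W (it m.+1 y).
    rewrite (_ : m.+1%:Z = m%:Z + 1)%R; last lia.
    by rewrite ziterD ziter1; apply: fwd => //; exact: (bounded_orbit_ziter 1%R).
  have Wy' : W y by exact: (coset_mem sW Wm (coset_sym sW (LW Lm 0))).
  exact: (coset_mem sW Wy' (coset_sym sW Wy)).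
move=> w Ww; apply: (adapted_core aW) => i; elim/int_rect: i => [//|n IH|n IH].
  by rewrite -addn1 PoszD ziterS; exact: WT.
apply: TW; rewrite -ziterS (_ : _ + _ = - n%:Z)%R//; lia.
Qed.

End BoundedOrbits.

(** * Symbolic models of the coset systems *)

Lemma hausdorff_of_separating_maps (X : topologicalType) :
  (forall x y : X, (forall (Z : topologicalType) (h : X -> Z),
     hausdorff_space Z -> continuous h -> h x = h y) -> x = y) ->
  hausdorff_space X.
Proof.
move=> sep x y xy; apply: sep => Z h hZ ch; apply: hZ => A B nA nB.
by have [z [Az Bz]] := xy _ _ (ch x A nA) (ch y B nB); exists (h z).
Qed.

Lemma prod_hausdorff (X Y : topologicalType) :
  hausdorff_space X -> hausdorff_space Y -> hausdorff_space (X * Y)%type.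
Proof.
move=> hX hY; apply: hausdorff_of_separating_maps => -[x y] [x' y'] sep.
congr pair.
  by apply: (sep X fst hX) => z; exact: cvg_fst.
by apply: (sep Y snd hY) => z; exact: cvg_snd.
Qed.

Lemma continuous_subsystem_val (X : system) (A : set X)
    (A_inv : forall x, A (act x) <-> A x) :
  continuous (fun x : subsystem A_inv => val x : X).
Proof. exact: (@initial_continuous A X set_val). Qed.

Lemma subsystem_hausdorff (X : system) (A : set X)
    (A_inv : forall x, A (act x) <-> A x) :
  hausdorff_space X -> hausdorff_space (subsystem A_inv).
Proof.
move=> hX; apply: hausdorff_of_separating_maps => x y sep; apply: val_inj.
by apply: (sep X _ hX); exact: continuous_subsystem_val.
Qed.

Lemma shift_system_hausdorff (A : choiceType) : hausdorff_space (shift_system A).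
Proof.
apply: (@hausdorff_product int (fun=> discrete_topology A)) => i.
exact: discrete_hausdorff.
Qed.

(** A periodic sequence is recovered from its word over one period, whose length gives that
    period. *)
Lemma periodic_markov_countable (B : countType) (E : set (B * B)) :
  countable [set y : markov_shift E | periodic act y].
Proof.
pose at_ (s : markov_shift E) (i : int) : B := (val s : shift_system B) i.
have iterE (n : nat) (s : markov_shift E) i : at_ (iter n act s) i = at_ s (i + n%:Z).
  elim: n i => [|n IH] i; first by rewrite addr0.
  rewrite iterS -[LHS]/(at_ (iter n act s) (i + 1%R)) IH.
  congr (at_ s _); lia.
have per (s : markov_shift E) (m : nat) (q i : int) : iter m act s = s ->
    at_ s (i + q * m%:Z)%R = at_ s i.
  move=> sm; have perS j : at_ s (j + m%:Z) = at_ s j by rewrite -iterE sm.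
  elim/int_rect: q => [|n IH|n IH]; first by rewrite mul0r addr0.
    by rewrite -IH -[RHS]perS; congr (at_ s _); lia.
  by rewrite -IH -[LHS]perS; congr (at_ s _); lia.
have /choice[w wP] : forall y : markov_shift E, exists m : nat,
    periodic act y -> (0 < m)%N /\ iter m act y = y.
  by move=> y; have [[m]|ny] := pselect (periodic act y); [exists m|exists 0%N].
pose word (y : markov_shift E) := [seq at_ y i%:Z | i <- iota 0 (w y)].
apply/countable_injP; exists (fun y => pickle (word y)) => y z.
move=> /set_mem/wP[m0 ym] /set_mem/wP[_ zm] /(pcan_inj pickleK) wyz.
have wE : w y = w z by have := congr1 size wyz; rewrite !size_map !size_iota.
apply: val_inj; apply/funext => i; rewrite -[LHS]/(at_ y i) -[RHS]/(at_ z i).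
have im0 : (0 <= i %% (w y)%:Z)%Z%R by apply: modz_ge0; lia.
have atmod s : iter (w y) act s = s -> at_ s i = at_ s (i %% (w y)%:Z)%Z.
  by move=> sm; rewrite {1}(divz_eq i (w y)%:Z) addrC per.
rewrite (atmod y ym) (atmod z); last by rewrite wE.
have := ltz_pmod i (d := (w y)%:Z); move: im0.
case: (i %% (w y)%:Z)%Z => // r _ r_lt.
have {r_lt} rw : (r < w y)%N by have := r_lt _; lia.
have := congr1 (fun s => nth (at_ y 0) s r) wyz.
rewrite /word -wE !(nth_map 0%N) ?size_iota//.
by rewrite nth_iota.
Qed.

Section OrbitModels.
Variables (G : topologicalGroupType) (T : automorphism G).
Implicit Types (x y : G) (V W L : set G).
Local Notation it := (ziter T).

(* [f] identifies the quotient system [G / core V] with [Y]. *)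
Record orbit_model V (Y : system) (f : G -> Y) : Prop := OrbitModel {
  model_hausdorff : hausdorff_space Y;
  model_continuous : continuous f;
  model_surjective : forall y : Y, exists x, f x = y;
  model_act : forall x, f (T x) = act (f x);
  model_fiber : forall x y, f x = f y <-> core T V (x^-1 * y);
  model_proper : forall y : Y, exists2 K : set G, compact K & exists U : set Y,
    [/\ open U, U y & f @^-1` U `<=` K]
}.

Definition itinerary (A : choiceType) (c : G -> A) (x : G) : shift_system A :=
  fun i => c (it i x).

Lemma itinerary_continuous (A : choiceType) (c : G -> A) :
  locally_constant c -> continuous (itinerary c).
Proof.
move=> lc; apply: continuous_prod_topology => i x.
apply: (@continuous_comp _ _ _ (it i) (c : G -> discrete_topology A)).
  exact: ziter_continuous.
exact: locally_constant_continuous.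
Qed.

Lemma itinerary_act (A : choiceType) (c : G -> A) x :
  itinerary c (T x) = act (itinerary c x).
Proof.
apply/funext => i; rewrite -[RHS]/(itinerary c x (i + 1%R)) /itinerary.
by rewrite ziterD.
Qed.

Lemma splitting_model L V W (D : finType) (f : G -> D) (Y : system) (h : G -> Y) :
  subgroup L -> adapted T L V -> splitting T L V W f -> orbit_model W h ->
  orbit_model V (Y := prod_system (full_shift D) Y)
    (fun x => (itinerary f x, h x)).
Proof.
move=> sL aV [aW LW lf fib onto] mh; split.
- apply: (@prod_hausdorff (full_shift D) Y); first exact: shift_system_hausdorff.
  exact: (model_hausdorff mh).
- apply: (@pair_continuous _ (full_shift D) Y); first exact: itinerary_continuous.
  exact: (model_continuous mh).
- move=> [d y]; have [g hg] := model_surjective mh y.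
  have [x Lx fx] := onto g d; exists x; congr pair; first exact/funext.
  by rewrite -hg; apply/esym/(model_fiber mh); exact: LW.
- by move=> x; rewrite itinerary_act (model_act mh).
- move=> x y; split=> [[fxy /(model_fiber mh)/(adapted_core sL aW) Lxy]|Vxy].
    by apply/(fib x y Lxy) => i; have := congr1 (fun s => s i) fxy.
  have Lxy := adapted_core sL aV Vxy; congr pair.
    by apply/funext; exact/(fib x y Lxy).
  by apply/(model_fiber mh); exact: LW.
- move=> [d y]; have [K cK [U [oU Uy UK]]] := model_proper mh y.
  exists K => //; exists (snd @^-1` U); split=> [|//|x]; last exact: (UK x).
  by apply: (@open_preimage (full_shift D * Y)%type Y snd U) oU => z; exact: cvg_snd.
Qed.

Hypothesis hG : hausdorff_space G.
Hypothesis scG : @second_countable G.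
Variables L W : set G.
Hypotheses (sL : subgroup L) (cL : compact L).
Hypothesis Lit : forall i x, L x -> L (it i x).
Hypothesis aW : adapted T L W.
Hypothesis LW : L `<=` core T W.

Let cosW : compact_open_subgroup W. Proof. by case: aW. Qed.
Let sW : subgroup W. Proof. by case: cosW. Qed.
Let oW : open W. Proof. by case: cosW. Qed.
Let cW : compact W. Proof. by case: cosW. Qed.
Let tW : tidy T W. Proof. by case: aW. Qed.

(** Here [W = L] is [T]-invariant, so [T] permutes the countable discrete [G / W]. By density each
    coset contains a bounded point, whose periodicity modulo [L] makes the orbit of the coset
    finite. *)
Lemma finite_orbit_perm_model : dense (bounded_orbit T) ->
  exists (D : countType) (pi : D -> D) (pi_bij : bijective pi)
    (h : G -> perm_system pi_bij),
    (forall d, finite_set (zorbit pi d)) /\ orbit_model W h.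
Proof.
move=> db; have WL := dense_bounded_open hG scG sL cL aW LW db.
have Wit i x : W (it i x) <-> W x.
  split=> [/WL/(Lit (- i))|/WL/LW/(_ i)//].
  by rewrite ziterNK => /LW/(_ 0).
have [c cP] := coset_code scG sW oW.
pose D : countType := {n : nat | `[< exists x, c x = n >]}.
have Dinj (d d' : D) : sval d = sval d' -> d = d'.
  by move=> E; apply: (@val_inj _ _ {n : nat | `[< exists x, c x = n >]}).
have cd_in x : `[< exists x', c x' = c x >] by apply/asboolP; exists x.
pose cd x : D := exist _ (c x) (cd_in x).
have cdP x y : cd x = cd y <-> W (x^-1 * y).
  by rewrite -cP; split=> [/(congr1 sval)//|E]; apply: Dinj.
have /choice[rep repP] : forall d : D, exists g : G, cd g = d.
  by move=> d; have /asboolP[x cx] := svalP d; exists x; apply: Dinj.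
pose pi_ i (d : D) := cd (it i (rep d)).
have piE i x : pi_ i (cd x) = cd (it i x).
  by apply/cdP; rewrite -ziterV -ziterM; apply/Wit/cdP; rewrite repP.
have piK i : cancel (pi_ i) (pi_ (- i)).
  by move=> d; rewrite -{1}(repP d) !piE ziterNK.
have pi_bij : bijective (pi_ 1%R).
  exists (pi_ (- 1)%R); first exact: piK.
  by move=> d; have := piK (- 1)%R d; rewrite opprK.
exists D, (pi_ 1%R), pi_bij, cd; split=> [d|].
  have [||x [Wx bx]] := db [set x | W ((rep d)^-1 * x)].
  - by exists (rep d); exact: coset_refl.
  - exact: open_preimage (@mulg_continuousl _ (rep d)^-1) oW.
  have [m m0 Lm] := bounded_orbit_periodic hG scG sL cL aW LW bx.
  apply: (@finite_zorbit _ _ _ m) => //; first exact: bij_inj.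
  have iterE n y : iter n (pi_ 1%R) (cd y) = cd (it n y).
    by elim: n => // n IH; rewrite iterS IH piE.
  have -> : d = cd x by rewrite -(repP d); exact/cdP.
  by rewrite iterE; apply/esym/cdP; exact: (LW Lm 0).
have lc : locally_constant cd.
  by apply: coset_code_locally_constant cdP _; exact: compact_open_subgroup_nbhs.
split.
- exact: discrete_hausdorff.
- exact: locally_constant_continuous.
- by move=> d; exists (rep d).
- by move=> x; rewrite -[RHS]/(pi_ 1%R (cd x)) piE.
- move=> x y; rewrite cdP; split=> [/WL/LW//|/(_ 0)]; exact.
- move=> d; exists [set x | W ((rep d)^-1 * x)]; first exact: compact_coset.
  exists [set d]; split=> //; first exact: discrete_open.
  by move=> x /= <-; apply/cdP; rewrite repP.
Qed.

(* Sequences over [nat] that are not codes of cosets are excluded by the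
   transition relation. *)
Lemma wandering_markov_model : ~ dense (bounded_orbit T) ->
  exists (B : countType) (E : set (B * B)) (h : G -> markov_shift E),
    essentially_wandering (markov_shift E) /\ orbit_model W h.
Proof.
move=> ndb; have [c cP] := coset_code scG sW oW.
pose E : set (nat * nat) := [set p | exists2 x, c x = p.1 & c (T x) = p.2].
have hin x : itinerary c x \in (@admissible nat E).
  apply/mem_set => i; exists (it i x) => //.
  by rewrite /itinerary ziterS.
pose h x : markov_shift E := exist _ (itinerary c x) (hin x).
have lc : locally_constant c.
  by apply: coset_code_locally_constant cP _; exact: compact_open_subgroup_nbhs.
have hval x i : (val (h x) : shift_system nat) i = c (it i x) by [].
have coord_continuous i :
    continuous (fun y : markov_shift E => (val y : shift_system nat) i :
      discrete_topology nat).
  move=> y; apply: (@continuous_comp _ _ _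
    (fun y : markov_shift E => val y : shift_system nat)
    (fun s : shift_system nat => s i : discrete_topology nat)).
    exact: continuous_subsystem_val.
  exact: (@proj_continuous _ (fun=> discrete_topology nat)).
have mh : orbit_model W h.
  split.
  - apply: subsystem_hausdorff; exact: shift_system_hausdorff.
  - by apply: continuous_set_val; exact: itinerary_continuous.
  - move=> y; have Ey : @admissible nat E (val y) by exact/set_mem/valP.
    have /choice[g gP] : forall i : int, exists g, c g = val y i /\ c (T g) = val y (i + 1%R).
      by move=> i; have [g ? ?] := Ey i; exists g.
    have [i|x xP] := realize_path cosW tW (g := g).
      exists (g i); first exact: coset_refl.
      by apply/cP; rewrite (gP i).2 (gP _).1.
    exists x; apply: val_inj; apply/funext => i.
    by rewrite hval -(gP i).1; apply/esym/cP.
  - by move=> x; apply: val_inj; exact: itinerary_act.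
  - move=> x y; split=> [hxy i|Wxy].
      rewrite ziterM ziterV; apply/cP.
      by rewrite -!hval hxy.
    apply: val_inj; apply/funext => i; rewrite !hval; apply/cP.
    by rewrite -ziterV -ziterM; exact: Wxy.
  - move=> y; pose K := [set x | c x = (val y : shift_system nat) 0].
    exists K.
      have [[g cg]|ng] := pselect (exists g, c g = (val y : shift_system nat) 0).
        have -> : K = [set x | W (g^-1 * x)]; last exact: compact_coset.
        by apply/seteqP; split=> x; rewrite /K /= -cg; [move=> /esym/cP|move=> /cP].
      have -> : K = set0; last exact: compact0.
      by apply/seteqP; split=> // x Kx; apply: ng; exists x.
    exists [set z | (val z : shift_system nat) 0 = (val y : shift_system nat) 0].
    split=> //.
    exact: open_preimage (coord_continuous 0) (@discrete_open (discrete_topology nat)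
      [set (val y : shift_system nat) 0]).
have hit n x : h (iter n T x) = iter n act (h x).
  by elim: n => // n IH; rewrite iterS (model_act mh) IH.
(* The coordinate at time 0 is bounded on the compact orbit closure, so the orbit of [x] stays in
   finitely many cosets of the compact [W]. *)
have bounded x : compact_orbit_closure act (h x) -> bounded_orbit T x.
  move=> ch; have ch0 := compact_image (coord_continuous 0) ch.
  have [n nP] : exists n, forall i : int, (c (it i x) < n)%N.
    have [||n nP] := @compact_locally_constant_bounded (discrete_topology nat) id _ _ _ ch0.
    - exact: discrete_hausdorff.
    - by move=> k; exact: discrete_set1.
    exists n => i; apply: nP; exists (h (it i x)) => //.
    apply: subset_closure.
    have [k [Ek|Ek]] := (zorbitP T x (it i x)).2 (ex_intro _ i erefl).
      by exists k; left; rewrite Ek hit.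
    by exists k; right; rewrite -hit Ek.
  have [Q cQ QP] : exists2 Q, compact Q & forall y, (c y < n)%N -> Q y.
    elim: n {nP} => [|n [Q cQ QP]]; first by exists set0 => //; exact: compact0.
    have [[g cg]|ng] := pselect (exists g, c g = n).
      exists (Q `|` [set y | W (g^-1 * y)]).
        by apply: compactU => //; exact: compact_coset.
      move=> y; rewrite ltnS leq_eqVlt => /orP[/eqP cy|/QP]; last by left.
      by right; apply/cP; rewrite cg cy.
    exists Q => // y; rewrite ltnS leq_eqVlt => /orP[/eqP cy|/QP//].
    by case: ng; exists y.
  by exists Q => // i; apply: QP; exact: nP.
have per (y : markov_shift E) : compact_orbit_closure act y -> periodic act y.
  have [x <-] := model_surjective mh y => /bounded bx.
  have [m m0 Lm] := bounded_orbit_periodic hG scG sL cL aW LW bx.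
  exists m; split=> //; rewrite -hit; apply/esym/(model_fiber mh); exact: LW.
have unbounded : exists y : markov_shift E, ~ compact_orbit_closure act y.
  apply: contrapT => nex; apply: ndb => O [x Ox] _; exists x; split=> //.
  by apply: bounded; apply: contrapT => nb; apply: nex; exists (h x).
exists nat, E, h; split=> //; split=> //.
- move=> fin; have [y ny] := unbounded; apply: ny.
  apply: finite_compact; apply: sub_finite_set fin; exact: subsetT.
- by apply: sub_countable (periodic_markov_countable E); exact: subset_card_le.
Qed.

End OrbitModels.

(** * The inverse limit *)

Section InverseLimitOfModels.
Variables (G : topologicalGroupType) (T : automorphism G).
Local Notation it := (ziter T).

Hypothesis hG : hausdorff_space G.
Hypothesis lcG : locally_compact [set: G].
Hypothesis tdG : totally_disconnected [set: G].
Hypothesis scG : @second_countable G.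

Lemma compact_open_subgroupI (U V : set G) :
  compact_open_subgroup U -> compact_open_subgroup V ->
  compact_open_subgroup (U `&` V).
Proof.
move=> cosU cosV; have [sU oU cU] := cosU; have [sV oV cV] := cosV; split.
- split=> [|x y [Ux Vx] [Uy Vy]|x [Ux Vx]].
  + by split; exact: subg1.
  + by split; exact: subgM.
  + by split; exact: subgV.
- exact: openI.
- by apply: compact_closedI => //; exact: compact_open_subgroup_closed.
Qed.

(** One subgroup from [van_dantzig] is chosen inside each basic open set containing 1; an index that
    numbers no such set gets an arbitrary one. *)
Lemma countable_compact_open_subgroup_basis : exists U : nat -> set G,
  (forall n, compact_open_subgroup (U n)) /\
  forall O, nbhs 1 O -> exists n, U n `<=` O.
Proof.
have [B cB [oB bB]] := scG; have /countable_injP[f fI] := cB.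
have /choice[U UP] : forall n, exists V, compact_open_subgroup V /\
    forall b, B b -> f b = n -> b 1 -> V `<=` b.
  move=> n; have [[b [Bb fb b1]]|nb] := pselect (exists b, [/\ B b, f b = n & b 1]).
    have nb : nbhs (1 : G) b by apply: open_nbhs_nbhs; split=> //; exact: oB.
    have [V cosV Vb] := van_dantzig hG lcG tdG nb.
    exists V; split=> // b' Bb' fb' _; suff -> : b' = b by [].
    by apply: fI; rewrite ?inE// fb'.
  have [V cosV _] := van_dantzig hG lcG tdG (filterT : nbhs (1 : G) setT).
  by exists V; split=> // b Bb fb b1; case: nb; exists b.
exists U; split=> [n|O nO]; first by case: (UP n).
have [b [Bb b1] bO] := bB 1 O nO.
exists (f b) => x Ux; apply: bO.
by have [_ /(_ b Bb erefl b1)] := UP (f b); apply.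
Qed.

(** Choose a decreasing sequence [V n] with [V n] inside [U n]. The maps to the models separate
    points because the [U n] shrink to 1, and reach every thread by compactness of the cosets of
    [core T (V n)]. *)
Lemma inverse_limit_of_models (P : system -> Prop) :
  (forall U, compact_open_subgroup U -> exists V, [/\ compact_open_subgroup V,
     V `<=` U & exists (Y : system) (f : G -> Y), P Y /\ orbit_model T V f]) ->
  conjugate_to_inverse_limit_of P T.
Proof.
move=> models; have [U [cosU Ubasis]] := countable_compact_open_subgroup_basis.
have /choice[h hP] : forall U0, exists V, compact_open_subgroup U0 ->
    [/\ compact_open_subgroup V, V `<=` U0 &
      exists (Y : system) (f : G -> Y), P Y /\ orbit_model T V f].
  move=> U0; have [/models[V VP]|nc] := pselect (compact_open_subgroup U0).
    by exists V.
  by exists U0.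
pose V := fix V n := if n is m.+1 then h (V m `&` U n) else h (U 0%N).
have cosV n : compact_open_subgroup (V n).
  elim: n => [|n IH] /=; first by have [] := hP _ (cosU 0%N).
  by have [] := hP _ (compact_open_subgroupI IH (cosU n.+1)).
have VS n : V n.+1 `<=` V n.
  have [_ hV _] := hP _ (compact_open_subgroupI (cosV n) (cosU n.+1)).
  by move=> x /hV[].
have VU n : V n `<=` U n.
  case: n => [|n]; first by have [] := hP _ (cosU 0%N).
  have [_ hV _] := hP _ (compact_open_subgroupI (cosV n) (cosU n.+1)).
  by move=> x /hV[].
have VP n : exists (Y : system) (f : G -> Y), P Y /\ orbit_model T (V n) f.
  case: n => [|n]; first by have [] := hP _ (cosU 0%N).
  by have [] := hP _ (compact_open_subgroupI (cosV n) (cosU n.+1)).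
pose Y n := projT1 (cid (VP n)).
pose f n : G -> Y n := projT1 (cid (projT2 (cid (VP n)))).
have PY n : P (Y n) by case: (projT2 (cid (projT2 (cid (VP n))))).
have fm n : orbit_model T (V n) (f n).
  by case: (projT2 (cid (projT2 (cid (VP n))))).
pose sec n (y : Y n) : G := projT1 (cid (model_surjective (fm n) y)).
have secK n y : f n (sec n y) = y := projT2 (cid (model_surjective (fm n) y)).
pose p n (y : Y n.+1) : Y n := f n (sec n.+1 y).
(* The section changes [x] only by an element of [core T (V n.+1)], which is contained in
   [core T (V n)]. *)
have pf n x : p n (f n.+1 x) = f n x.
  apply/(model_fiber (fm n)) => i; apply: VS.
  by have /(model_fiber (fm n.+1)) := secK n.+1 (f n.+1 x); exact.
have p_factor n : factor_map (p n).
  split.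
  - apply: (continuous_of_proper_surjection (model_hausdorff (fm n.+1))
      (model_continuous (fm n.+1)) (model_surjective (fm n.+1))
      (model_proper (fm n.+1))).
    rewrite (_ : p n \o f n.+1 = f n); first exact: (model_continuous (fm n)).
    by apply/funext => x; exact: pf.
  - move=> y; have [x fx] := model_surjective (fm n) y.
    by exists (f n.+1 x); rewrite pf.
  - move=> y; rewrite -(secK n.+1 y) -(model_act (fm n.+1)) !pf.
    exact: model_act (fm n) _.
exists Y, p, p_factor; split=> //.
have thread_in x : (fun n => f n x) \in @threads Y p.
  by apply/mem_set => n; exact: pf.
pose F x : inverse_limit p_factor := exist _ (fun n => f n x) (thread_in x).
have coord_continuous n : continuous (fun y : inverse_limit p_factor =>
    (val y : pointwise_system Y) n).
  move=> y; apply: (@continuous_comp _ _ _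
    (fun y : inverse_limit p_factor => val y : pointwise_system Y)
    (fun s : pointwise_system Y => s n)).
    exact: continuous_subsystem_val.
  exact: (@proj_continuous _ (fun n => Defs.space (Y n))).
have F_continuous : continuous F.
  apply: continuous_set_val; apply: continuous_prod_topology => n.
  exact: (model_continuous (fm n)).
have F_inj : injective F.
  move=> x y Fxy; have Vxy n : V n (x^-1 * y).
    have /(model_fiber (fm n))/(_ 0) // : f n x = f n y.
    by have := congr1 (fun z => (val z : pointwise_system Y) n) Fxy.
  have /esym/eqP : 1 = x^-1 * y.
    apply: hG => A B /Ubasis[n UA] /nbhs_singleton Bxy.
    by exists (x^-1 * y); split=> //; exact/UA/VU/Vxy.
  by rewrite -(inj_eq (mulgI x)) mulVKg mulg1 => /eqP.
have F_surj (y : inverse_limit p_factor) : exists x, F x = y.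
  have ty n : p n ((val y : pointwise_system Y) n.+1) = (val y : pointwise_system Y) n.
    by have /set_mem := valP y; exact.
  pose C n := [set x | f n x = (val y : pointwise_system Y) n].
  have cC n : compact (C n).
    have [g fg] := model_surjective (fm n) ((val y : pointwise_system Y) n).
    have -> : C n = [set x | core T (V n) (g^-1 * x)].
      by apply/seteqP; split=> x; rewrite /C /= -fg;
        [move=> /esym/(model_fiber (fm n))|move=> /(model_fiber (fm n))].
    apply: compact_coset; have [_ _ cV] := cosV n.
    apply: subclosed_compact cV _.
      exact: core_closed (compact_open_subgroup_closed (cosV n)).
    by move=> x /(_ 0).
  have [||||x Cx] := @compact_nested_nonempty _ C.
  - exact: cC.
  - by move=> n; exact: compact_closed.
  - by move=> n x Cx; rewrite /C /= -ty -Cx pf.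
  - move=> n; have [x fx] := model_surjective (fm n) ((val y : pointwise_system Y) n).
    by exists x.
  exists x; apply: val_inj; apply: functional_extensionality_dep => n; exact: Cx.
have /choice[g gK] := F_surj.
exists F; split; last first.
  move=> x; apply: val_inj; apply: functional_extensionality_dep => n.
  exact: model_act (fm n) x.
split=> //; exists g; split=> //; first by move=> x; apply: F_inj; rewrite gK.
have hlim : hausdorff_space (inverse_limit p_factor).
  apply: subsystem_hausdorff.
  apply: (@hausdorff_product nat (fun n => Defs.space (Y n))) => n.
  exact: (model_hausdorff (fm n)).
(* Properness of [F] is inherited from its coordinate 0. *)
apply: (continuous_of_proper_surjection hlim F_continuous F_surj).
- move=> y.
  have [K cK [O [oO Oy OK]]] := model_proper (fm 0%N) ((val y : pointwise_system Y) 0%N).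
  exists K => //.
  exists ((fun y : inverse_limit p_factor => (val y : pointwise_system Y) 0%N) @^-1` O).
  by split=> //; exact: open_preimage (coord_continuous 0%N) oO.
- rewrite (_ : g \o F = id) => [x|]; first exact: cvg_id.
  by apply/funext => x; apply: F_inj; rewrite /= gK.
Qed.

Lemma exists_split_subgroup U : compact_open_subgroup U ->
  exists V L W (D : finType) (phi : G -> D),
    [/\ compact_open_subgroup V, V `<=` U, adapted T L V, splitting T L V W phi &
      [/\ subgroup L, compact L & forall i x, L x -> L (it i x)]].
Proof.
move=> cosU; have [V [cosV VU tV nV]] := exists_normalized_tidy T hG scG cosU.
pose L := closure (homoclinic T V).
have sL : subgroup L by apply: closure_homoclinic_subgroup; case: cosV.
have cL : compact L by exact: closure_homoclinic_compact.
have Lit i x : L x -> L (it i x) by exact: closure_homoclinic_ziter.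
have aV : adapted T L V by exact: adapted_closure_homoclinic.
have [W [D [phi sp]]] := exists_splitting hG scG sL cL Lit aV.
by exists V, L, W, D, phi.
Qed.

End InverseLimitOfModels.

Theorem theorem6p8 (G : topologicalGroupType) (T : G -> G)
    (G_second_countable : @second_countable G)
    (G_hausdorff : hausdorff_space G)
    (G_locally_compact : locally_compact [set: G])
    (G_totally_disconnected : totally_disconnected [set: G])
    (T_continuous : continuous T)
    (T_morph : {morph T : x y / (x * y)%g})
    (T_bij : bijective T) :
  (dense (compact_orbit_closure T) ->
     conjugate_to_inverse_limit_of fullshift_times_finite_orbit_perm T) /\
  (~ dense (compact_orbit_closure T) ->
     conjugate_to_inverse_limit_of fullshift_times_wandering_markov T).
Proof.
have [Ti TK TiK] := T_bij.
have cTi : continuous Ti := inverse_automorphism_continuous G_hausdorff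
  G_locally_compact G_totally_disconnected G_second_countable T_continuous
  T_morph TK TiK.
pose A := Automorphism T_continuous cTi T_morph TK TiK.
have -> : compact_orbit_closure T = bounded_orbit A.
  by apply/funext => x; apply/propext; exact: (@compact_orbit_closureP G A).
split=> db; apply: (@inverse_limit_of_models G A) => // U cosU;
  have [V [L [W [D [phi [cosV VU aV sp [sL cL Lit]]]]]]] :=
    exists_split_subgroup A G_hausdorff G_second_countable cosU;
  have [aW LW _ _ _] := sp; exists V; split=> //.
- have [B [pi [pi_bij [h [fin mh]]]]] := finite_orbit_perm_model
    G_hausdorff G_second_countable sL cL Lit aW LW db.
  exists (prod_system (full_shift D) (perm_system pi_bij)).
  exists (fun x => (itinerary A phi x, h x)).
  by split; [exists D, B, pi, pi_bij|exact: splitting_model sL aV sp mh].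
- have [B [E [h [ew mh]]]] := wandering_markov_model
    G_hausdorff G_second_countable sL cL aW LW db.
  exists (prod_system (full_shift D) (markov_shift E)).
  exists (fun x => (itinerary A phi x, h x)).
  by split; [exists D, B, E|exact: splitting_model sL aV sp mh].
Qed.
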